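(* Let $p\in[1,\infty)$ and let $(\rho_t)_{t\in I}\subset L^1_{\rm loc}(\mathbb R^N)$ be non-negative. Assume that for every $\varepsilon>0$ there exists $\delta\in(0,1]$ such that $\frac{\rho_t(z)}{|z|^p}\ge\frac1{\varepsilon\delta^N}$ for a.e. $z\in B_\delta$ and every $t\in(0,\delta)$. If $(t_k)_{k\in\mathbb N}\subset I$ is infinitesimal and $(u_k)_{k\in\mathbb N}\subset L^p(\mathbb R^N)$ satisfies $\sup_k\big(\|u_k\|_{L^p}+\mathcal F_{t_k,p}(u_k)\big)<\infty$, then $(u_k)$ is locally precompact in $L^p(\mathbb R^N)$ and any of its $L^p_{\rm loc}(\mathbb R^N)$ limits belongs to $W^{\kappa,p}(\mathbb R^N)$, where $\kappa(z)=\liminf_{t\to0^+}\frac{\rho_t(z)}{|z|^p}$ for a.e. $z\in\mathbb R^N$.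
   Context: $I=(0,1)$; $B_\delta$ is the open ball of radius $\delta$ centred at $0$. For $u\in L^p(\mathbb R^N)$, $\mathcal F_{t,p}(u)=\int\int\frac{|u(x)-u(y)|^p}{|x-y|^p}\rho_t(x-y)\,dx\,dy$. For measurable $\kappa\colon\mathbb R^N\to[0,\infty]$, $W^{\kappa,p}(\mathbb R^N)=\{u\in L^p(\mathbb R^N):\int\int|u(x)-u(y)|^p\kappa(x-y)\,dx\,dy<\infty\}$. A subset of $L^p(\mathbb R^N)$ is locally precompact if it is precompact in $L^p(E)$ for every compact $E\subset\mathbb R^N$. *)

(* Defs.v *)
From HB Require Import structures.
From mathcomp Require Import all_boot all_order all_algebra.
From mathcomp Require Import all_classical all_reals all_analysis.
Set Implicit Arguments. Unset Strict Implicit. Unset Printing Implicit Defensive.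
Import Order.TTheory GRing.Theory Num.Theory.
Local Open Scope classical_set_scope.
Local Open Scope ring_scope.

(* R^N is modelled as N.-tuple R, with the product (= Borel) sigma-algebra
   provided by MathComp-Analysis. *)

Definition tsub (R : realType) (N : nat) (x y : N.-tuple R) : N.-tuple R :=
  [tuple tnth x i - tnth y i | i < N].

Definition enorm (R : realType) (N : nat) (z : N.-tuple R) : R :=
  Num.sqrt (\sum_(i < N) tnth z i ^+ 2).

Definition eball0 (R : realType) (N : nat) (r : R) : set (N.-tuple R) :=
  [set z | enorm z < r].

Definition eopen (R : realType) (N : nat) (O : set (N.-tuple R)) : Prop :=
  forall x, O x -> exists2 r : R, 0 < r & [set y | enorm (tsub y x) < r] `<=` O.

Definition ecompact (R : realType) (N : nat) (E : set (N.-tuple R)) : Prop :=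
  forall (I : Type) (O : I -> set (N.-tuple R)),
    (forall i, eopen (O i)) -> E `<=` \bigcup_i O i ->
    exists2 F : set I, finite_set F & E `<=` \bigcup_(i in F) O i.

(* mu is the N-dimensional Lebesgue measure (on the Borel sets): it gives every
   closed box its volume. (This characterises it uniquely.) *)
Definition is_lebesgue_measure (R : realType) (N : nat)
    (mu : {measure set (N.-tuple R) -> \bar R}) : Prop :=
  forall a b : N.-tuple R, (forall i, tnth a i <= tnth b i) ->
    mu [set x | forall i, tnth a i <= tnth x i <= tnth b i] =
    (\prod_(i < N) (tnth b i - tnth a i))%:E.

Definition Ftp (R : realType) (N : nat) (mu : {measure set (N.-tuple R) -> \bar R})
    (rho : R -> N.-tuple R -> R) (t p : R) (u : N.-tuple R -> R) : \bar R :=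
  (\int[mu]_x \int[mu]_y
     ((`|u x - u y| `^ p / (enorm (tsub x y)) `^ p) * rho t (tsub x y))%:E)%E.

Definition liminf0 (R : realType) (g : R -> R) : \bar R :=
  ereal_sup [set ereal_inf [set (g t)%:E | t in `]0, d[ ] | d in `]0, 1[ ].

Definition kappa (R : realType) (N : nat) (rho : R -> N.-tuple R -> R) (p : R)
    (z : N.-tuple R) : \bar R :=
  liminf0 (fun t => rho t z / (enorm z) `^ p).

Definition Wkp (R : realType) (N : nat) (mu : {measure set (N.-tuple R) -> \bar R})
    (k : N.-tuple R -> \bar R) (p : R) (v : N.-tuple R -> R) : Prop :=
  [/\ measurable_fun setT v,
      ('N[mu]_(p%:E) [EFin \o v] < +oo)%E &
      (\int[mu]_x \int[mu]_y ((`|v x - v y| `^ p)%:E * k (tsub x y)) < +oo)%E].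

Definition Lp_distE (R : realType) (N : nat) (mu : {measure set (N.-tuple R) -> \bar R})
    (p : R) (E : set (N.-tuple R)) (f g : N.-tuple R -> R) : \bar R :=
  (\int[mu]_(x in E) (`|f x - g x| `^ p)%:E)%E.

Definition in_LpE (R : realType) (N : nat) (mu : {measure set (N.-tuple R) -> \bar R})
    (p : R) (E : set (N.-tuple R)) (f : N.-tuple R -> R) : Prop :=
  measurable_fun E f /\ (\int[mu]_(x in E) (`|f x| `^ p)%:E < +oo)%E.

Definition precompact_LpE (R : realType) (N : nat)
    (mu : {measure set (N.-tuple R) -> \bar R}) (p : R) (E : set (N.-tuple R))
    (u : nat -> N.-tuple R -> R) : Prop :=
  forall s : nat -> nat, exists (phi : nat -> nat) (v : N.-tuple R -> R),
    [/\ {homo phi : m n / (m < n)%N >-> (m < n)%N}, in_LpE mu p E v &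
        (fun n => Lp_distE mu p E (u (s (phi n))) v) @ \oo --> 0%E].

Definition locally_precompact_Lp (R : realType) (N : nat)
    (mu : {measure set (N.-tuple R) -> \bar R}) (p : R)
    (u : nat -> N.-tuple R -> R) : Prop :=
  forall E, ecompact E -> precompact_LpE mu p E u.

Definition Lploc_limit (R : realType) (N : nat)
    (mu : {measure set (N.-tuple R) -> \bar R}) (p : R)
    (u : nat -> N.-tuple R -> R) (v : N.-tuple R -> R) : Prop :=
  measurable_fun setT v /\
  exists phi : nat -> nat, {homo phi : m n / (m < n)%N >-> (m < n)%N} /\
    forall E, ecompact E -> in_LpE mu p E v /\
      (fun n => Lp_distE mu p E (u (phi n)) v) @ \oo --> 0%E.

(* Main.v *)
Require Import Defs.
From HB Require Import structures.
From mathcomp Require Import all_boot all_order all_algebra.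
From mathcomp Require Import finmap.
From mathcomp Require Import all_classical all_reals all_analysis.
From mathcomp Require Import measurable_realfun.
From mathcomp Require Import ring lra.
Set Implicit Arguments. Unset Strict Implicit. Unset Printing Implicit Defensive.
Import Order.TTheory GRing.Theory Num.Theory numFieldTopology.Exports numFieldNormedType.Exports.
Local Open Scope classical_set_scope.
Local Open Scope ring_scope.

(* The lower bound on rho_t says that, for t_k < delta, the mass of
   |u_k(x) - u_k(y)|^p over pairs at distance < delta is at most
   eps delta^N sup F. Cut R^N into cubes of side comparable to delta: on each
   cube some value u_k(y) approximates u_k as well as the average over y does,
   so u_k is within C eps (in p-th power) of a step function, uniformly in k.
   Step functions on finitely many cubes with bounded values form a totally
   bounded family, which gives local precompactness by a diagonal argument and
   Fatou. For the limit, kappa(z) is bounded by the lower limit along t_k, and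
   Fatou applies to both iterated integrals along an a.e. convergent
   subsequence. *)

(** * Boxes and invariance of Lebesgue measure *)

(** Choosing a value of u_k in a cell costs a division by the measure of the cell, which is
    comparable to delta^N. This cancels the delta^N of the lower bound on rho_t and leaves C eps,
    with C depending only on N and the energy bound; hence eps can be fixed before delta is known.
    Only the indices with t_k < delta are controlled in this way, and the finitely many others each
    form a class of their own. Total boundedness is phrased as a finite coloring of the indices,
    equal colors meaning close functions, because a coloring composes with an arbitrary sequence of
    indices [s]. *)

Definition box (R : realType) (N : nat) (a b : N.-tuple R) : set (N.-tuple R) :=
  [set x | forall i, tnth a i <= tnth x i <= tnth b i].

Lemma tnth_tsub (R : realType) (N : nat) (x y : N.-tuple R) i :
  tnth (tsub x y) i = tnth x i - tnth y i.
Proof. by rewrite tnth_mktuple. Qed.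

Lemma measurable_forall_tnth (R : realType) (N : nat) (A : 'I_N -> set R) :
  (forall i, measurable (A i)) ->
  measurable [set x : N.-tuple R | forall i, A i (tnth x i)].
Proof.
move=> mA.
rewrite (_ : [set _ | _] = \bigcap_(i in [set: 'I_N]) ((@tnth N R ^~ i) @^-1` A i)).
  apply: fin_bigcap_measurable => [|i _]; first exact: finite_finset.
  by rewrite -[X in measurable X]setTI; apply: measurable_tnth.
by apply/seteqP; split => [x + i _|x + i]; apply.
Qed.

Lemma measurable_box (R : realType) (N : nat) (a b : N.-tuple R) :
  measurable (box a b).
Proof.
pose A i := [set` `[tnth a i, tnth b i]].
rewrite (_ : box a b = [set x | forall i, A i (tnth x i)]).
  by apply: measurable_forall_tnth => i; exact: measurable_itv.
by apply/seteqP; split => x xab i; move: (xab i); rewrite /A /= in_itv.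
Qed.

Lemma boxI (R : realType) (N : nat) (a b c d : N.-tuple R) :
  box a b `&` box c d =
  box [tuple Num.max (tnth a i) (tnth c i) | i < N]
      [tuple Num.min (tnth b i) (tnth d i) | i < N].
Proof.
apply/seteqP; split => [x [xab xcd] i|x h].
  rewrite !tnth_mktuple ge_max le_min; have /andP[a1 a2] := xab i.
  by have /andP[b1 b2] := xcd i; apply/andP; split; apply/andP; split.
by split => i; have := h i; rewrite !tnth_mktuple ge_max le_min;
  move=> /andP[/andP[a1 a2] /andP[b1 b2]]; apply/andP; split.
Qed.

Definition cube (R : realType) (N : nat) (r : R) : set (N.-tuple R) :=
  box [tuple - r | i < N] [tuple r | i < N].

Lemma cubeE (R : realType) (N : nat) (r : R) (x : N.-tuple R) :
  cube r x <-> forall i, `|tnth x i| <= r.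
Proof.
by split => h i; have := h i; rewrite ?tnth_mktuple ler_norml.
Qed.

Lemma le_cube (R : realType) (N : nat) (r s : R) : r <= s ->
  @cube R N r `<=` cube s.
Proof. by move=> rs x /cubeE h; apply/cubeE => i; exact: le_trans (h i) rs. Qed.

Lemma bigcup_cube (R : realType) (N : nat) :
  \bigcup_n @cube R N n%:R = setT.
Proof.
apply/seteqP; split => // x _.
exists (\max_(i < N) (Num.truncn `|tnth x i|).+1)%N => //; apply/cubeE => i.
apply/ltW/(lt_le_trans (truncnS_gt _)); rewrite ler_nat.
exact: (leq_bigmax i).
Qed.

(** Closed boxes are the only sets whose measure is prescribed, so the uniqueness theorem for
    measures has to be applied with them as generators. *)
Lemma measurable_tuple_boxes (R : realType) (N : nat) :
  @measurable _ (N.-tuple R) =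
  <<s [set A | exists a b, A = box a b] >>.
Proof.
apply/seteqP; split; last first.
  apply: smallest_sub; first exact: sigma_algebra_measurable.
  by move=> _ [a [b ->]]; exact: measurable_box.
apply: smallest_sub; first exact: smallest_sigma_algebra.
rewrite -bigcup_seq; apply: bigcup_sub => i _ _ [B mB <-]; rewrite setTI.
pose S := [set B : set R | <<s [set A | exists a b, A = box a b] >>
  ((@tnth N R ^~ i) @^-1` B)].
have mR : (measurable : set (set R)) = <<s @RGenCInfty.G R >>.
  exact: RGenCInfty.measurableE.
suff /(_ B) : <<s @RGenCInfty.G R >> `<=` S by rewrite -mR; exact.
apply: smallest_sub => [|_ [x ->]].
  split.
  - by rewrite /S /= preimage_set0; exact: sigma_algebra0.
  - by move=> A SA; rewrite /S /= setTD preimage_setC; exact: sigma_algebraC.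
  - move=> F SF; rewrite /S /= preimage_bigcup; exact: sigma_algebra_bigcup.
(* A half-space [x <= tnth y i] is exhausted by boxes bounded by n in absolute value, except that
   the i-th lower bound is x. *)
rewrite /S /= (_ : _ @^-1` _ = \bigcup_(n : nat) 
  box [tuple if j == i then x else - n%:R | j < N] [tuple n%:R | j < N]).
  apply: sigma_algebra_bigcup => n; apply: sub_sigma_algebra.
  by do 2 eexists.
apply/seteqP; split => [y /= xy|y [n _ /(_ i)]]; last first.
  by rewrite !tnth_mktuple eqxx /= in_itv /= andbT => /andP[].
have [n _ /cubeE yn] : (\bigcup_n @cube R N n%:R) y by rewrite bigcup_cube.
exists n => // j; move: (yn j); rewrite !tnth_mktuple ler_norml.
by case: eqVneq => [->|//] /andP[_ ->]; rewrite andbT; move: xy; rewrite in_itv /= andbT.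
Qed.

Lemma lebesgue_box_empty (R : realType) (N : nat) (a b : N.-tuple R) i :
  tnth b i < tnth a i -> box a b = set0.
Proof.
move=> ba; apply/seteqP; split => // x /(_ i) /andP[ax xb].
by have := le_trans ax xb; rewrite leNgt ba.
Qed.

Lemma measurable_tsub (R : realType) (N : nat) (d : measure_display) (T : measurableType d)
    (f g : T -> N.-tuple R) :
  measurable_fun setT f -> measurable_fun setT g ->
  measurable_fun setT (fun x => tsub (f x) (g x)).
Proof.
move=> /measurable_fun_tnthP mf /measurable_fun_tnthP mg.
apply/measurable_fun_tnthP => i.
rewrite (_ : _ \o _ = (fun x => tnth (f x) i - tnth (g x) i)).
  by apply: measurable_funB; [exact: mf|exact: mg].
by apply/funext => x /=; rewrite tnth_tsub.
Qed.

Section lebesgue.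
Context (R : realType) (N : nat).
Variable mu : {measure set (N.-tuple R) -> \bar R}.
Hypothesis muL : is_lebesgue_measure mu.

Lemma lebesgue_cube_lty r : (mu (cube r) < +oo)%E.
Proof.
have [r0|r0] := leP 0 r.
  by rewrite muL ?ltry// => i; rewrite !tnth_mktuple; lra.
apply: (@le_lt_trans _ _ (mu (cube 0))).
  rewrite le_measure// ?inE; try exact: measurable_box.
  exact/le_cube/ltW.
by rewrite muL ?ltry// => i; rewrite !tnth_mktuple; lra.
Qed.

Lemma lebesgue_sigma_finite : sigma_finite setT mu.
Proof.
exists (fun n => cube n%:R); first by rewrite bigcup_cube.
move=> n; split; [exact: measurable_box|exact: lebesgue_cube_lty].
Qed.

(** The reflection y -> x - y maps a box to a box with the same side lengths. Hence [mu] and its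
    pushforward agree on boxes, which are stable under intersection, and the cubes exhaust the space
    with finite measure. *)
Lemma lebesgue_tsub (x : N.-tuple R) (A : set (N.-tuple R)) : measurable A ->
  mu (tsub x @^-1` A) = mu A.
Proof.
move=> mA.
have mx : measurable_fun setT (tsub x).
  by apply: (measurable_tsub (f := fun=> x)) => //; exact: measurable_cst.
pose m2 : {measure set _ -> \bar R} :=
  measure_function_pushforward__canonical__measure_function_Measure mu mx.
apply/esym/(measure_unique [set A | exists a b, A = box a b]
  (fun n => cube n%:R) _ _ _ _ mu m2) => //.
- exact: measurable_tuple_boxes.
- by move=> _ _ [a [b ->]] [c [e ->]]; rewrite boxI; do 2 eexists.
- by move=> n; rewrite /cube; do 2 eexists.
- exact: bigcup_cube.
- move=> _ [a [b ->]]; change (mu (box a b) = mu (tsub x @^-1` box a b)).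
  rewrite (_ : _ @^-1` _ = box (tsub x b) (tsub x a)); last first.
    apply/seteqP; split => y h i; have := h i; rewrite !tnth_tsub => /andP[]; lra.
  (* The volume formula is only available for ordered corners; otherwise both boxes are empty. *)
  case: (pselect (forall i, tnth a i <= tnth b i)) => [ab|].
    rewrite !muL// => [|i]; last by rewrite !tnth_tsub lerB.
    by congr EFin; apply: eq_bigr => i _; rewrite !tnth_tsub; ring.
  move=> /existsNP[i /negP]; rewrite -ltNge => ba.
  by rewrite !(@lebesgue_box_empty _ _ _ _ i) ?tnth_tsub ?ltrD2l ?ltrN2.
- by move=> n; exact: lebesgue_cube_lty.
Qed.

Lemma lebesgue_negligible_tsub (x : N.-tuple R) (P : N.-tuple R -> Prop) :
  {ae mu, forall z, P z} -> {ae mu, forall y, P (tsub x y)}.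
Proof.
move=> [A [mA A0 PA]]; exists (tsub x @^-1` A); split.
- rewrite -[X in measurable X]setTI.
  by apply: (measurable_tsub (f := fun=> x)) => //; exact: measurable_cst.
- by rewrite lebesgue_tsub.
- by move=> y /= nP; apply: PA.
Qed.

End lebesgue.

(** * Euclidean norm and compact sets *)

Lemma enorm_ge_tnth (R : realType) (N : nat) (z : N.-tuple R) i :
  `|tnth z i| <= enorm z.
Proof.
rewrite -sqrtr_sqr ler_wsqrtr// (bigD1 i)//= lerDl sumr_ge0// => j _.
exact: sqr_ge0.
Qed.

Lemma enorm_lt (R : realType) (N : nat) (z : N.-tuple R) (h d : R) :
  0 < d -> N%:R * h ^+ 2 < d ^+ 2 -> (forall i, `|tnth z i| <= h) -> enorm z < d.
Proof.
move=> d0 hd zh; rewrite -(ltr_pXn2r (n := 2)) ?nnegrE ?sqrtr_ge0 ?ltW//.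
rewrite sqr_sqrtr; last by apply: sumr_ge0 => i _; exact: sqr_ge0.
apply: le_lt_trans hd; rewrite -[N in N%:R]card_ord -sum1_card natr_sum mulr_suml.
apply: ler_sum => i _; rewrite mul1r -real_normK ?num_real//.
by rewrite ler_pXn2r ?nnegrE// (le_trans _ (zh i)).
Qed.

Lemma enorm_lt_div (R : realType) (N : nat) (z : N.-tuple R) (d : R) :
  (0 < N)%N -> 0 < d -> (forall i, `|tnth z i| <= d / (2 * N%:R)) -> enorm z < d.
Proof.
move=> N0 d0; apply: enorm_lt => //.
have N1 : (1 : R) <= N%:R by rewrite ler1n.
rewrite expr_div_n mulrA ltr_pdivrMr ?exprn_gt0 ?mulr_gt0//; last lra.
rewrite mulrC ltr_pM2l ?exprn_gt0//; nra.
Qed.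

Lemma measurable_enorm (R : realType) (N : nat) :
  measurable_fun setT (@enorm R N).
Proof.
have ms : measurable_fun setT (fun z : N.-tuple R => \sum_(i < N) tnth z i ^+ 2).
  apply: measurable_sum => i; apply: measurable_funX; exact: measurable_tnth.
rewrite (_ : @enorm R N = (fun z => (\sum_(i < N) tnth z i ^+ 2) `^ 2^-1)).
  exact: (measurableT_comp (measurable_powR _)).
by apply/funext => z; rewrite powR12_sqrt// sumr_ge0// => i _; exact: sqr_ge0.
Qed.

Lemma eopen_cube (R : realType) (N : nat) (c : N.-tuple R) (r : R) :
  eopen [set y | forall i, `|tnth y i - tnth c i| < r].
Proof.
move=> x xr.
(* The default [r - 1] keeps the maximum below [r] even when there is no coordinate. *)
pose m : R := \big[Num.max/(r - 1)]_(i < N) `|tnth x i - tnth c i|.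
have mr : m < r.
  rewrite /m; elim/big_ind : _ => //; first lra.
  by move=> a b ar br; rewrite gt_max ar.
exists (r - m); first by rewrite subr_gt0.
move=> y /= ym i.
have h1 : `|tnth x i - tnth c i| <= m by rewrite /m; exact: le_bigmax.
have h2 := le_lt_trans (enorm_ge_tnth (tsub y x) i) ym; rewrite tnth_tsub in h2.
rewrite -(subrKA (tnth x i)); apply: le_lt_trans (ler_normD _ _) _; lra.
Qed.

Lemma eopen_far (R : realType) (N : nat) (c : N.-tuple R) (r : R) :
  eopen [set y | exists i, r < `|tnth y i - tnth c i|].
Proof.
move=> x [i ri]; exists (`|tnth x i - tnth c i| - r); first by rewrite subr_gt0.
move=> y /= yr; exists i.
have h2 := le_lt_trans (enorm_ge_tnth (tsub y x) i) yr; rewrite tnth_tsub in h2.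
have := ler_normB (tnth y i - tnth c i) (tnth y i - tnth x i).
by rewrite opprB addrC subrKA; lra.
Qed.

Lemma finite_set_nat_bounded (F : set nat) : finite_set F ->
  exists n, forall k, F k -> (k <= n)%N.
Proof.
by move/finite_seqP => [s ->]; exists (\max_(k <- s) k)%N => k /= ks; exact: leq_bigmax_seq.
Qed.

Lemma ecompact_bounded (R : realType) (N : nat) (E : set (N.-tuple R)) :
  ecompact E -> exists n : nat, E `<=` cube n%:R.
Proof.
move=> cE.
have [||F finF EF] := cE nat (fun n => [set y | forall i,
    `|tnth y i - tnth [tuple (0 : R) | i < N] i| < n%:R]).
- by move=> n; exact: eopen_cube.
- move=> x _; have [n _ /cubeE xn] : (\bigcup_n @cube R N n%:R) x by rewrite bigcup_cube.
  exists n.+1 => //= i; rewrite tnth_mktuple subr0 (le_lt_trans (xn i))//.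
  by rewrite ltr_nat.
have [n Fn] := finite_set_nat_bounded finF.
exists n => x /EF[k Fk xk]; apply/cubeE => i; apply/ltW.
have := xk i; rewrite tnth_mktuple subr0 => /lt_le_trans; apply.
by rewrite ler_nat Fn.
Qed.

(** E is the intersection over n of finite unions of open cubes of radius 1/(n+1) centred in E. A
    point of this intersection outside E would, by a second finite subcover, have sup-distance to E
    bounded below, contradicting a fine enough union. *)
Lemma ecompact_measurable (R : realType) (N : nat) (E : set (N.-tuple R)) :
  ecompact E -> measurable E.
Proof.
move=> cE.
have /choice[U HU] : forall n : nat, exists U : set (N.-tuple R),
    [/\ measurable U, E `<=` U & forall x, U x ->
      exists2 c, E c & forall i, `|tnth x i - tnth c i| < n.+1%:R^-1].
  move=> n.
  have [||F finF EF] := cE (N.-tuple R) (fun c => [set y | E c /\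
      forall i, `|tnth y i - tnth c i| < n.+1%:R^-1]).
  - by move=> c x [Ec xc]; have [r r0 rO] := eopen_cube xc; exists r => // y /rO.
  - by move=> x Ex; exists x => //=; split => // i; rewrite subrr normr0 invr_gt0.
  exists (\bigcup_(c in F) [set y | E c /\
      forall i, `|tnth y i - tnth c i| < n.+1%:R^-1]); split => //; last first.
    by move=> x [c _ [Ec xc]]; exists c.
  apply: fin_bigcup_measurable => // c _.
  have [Ec|nEc] := pselect (E c); last first.
    by rewrite (_ : [set _ | _] = set0)//; apply/seteqP; split => // y [].
  pose A i := [set` `]tnth c i - n.+1%:R^-1, tnth c i + n.+1%:R^-1[].
  rewrite (_ : [set _ | _] = [set y | forall i, A i (tnth y i)]).
    by apply: measurable_forall_tnth => i; exact: measurable_itv.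
  apply/seteqP; split => [y [_ h] i|y h].
    by have := h i; rewrite /A /= in_itv/= ltr_distl.
  by split => // i; have := h i; rewrite /A /= in_itv/= ltr_distl.
rewrite (_ : E = \bigcap_n U n).
  by apply: bigcapT_measurable => n; have [] := HU n.
apply/seteqP; split => [x Ex n _|x Ux]; first by have [_ + _] := HU n; apply.
apply: contrapT => nEx.
have [||F finF EF] := cE nat (fun m => [set y | exists i, m.+1%:R^-1 < `|tnth y i - tnth x i|]).
- by move=> m; exact: eopen_far.
- move=> y Ey; have : y != x by apply/eqP => yx; apply: nEx; rewrite -yx.
  move=> /eqP yx; have [i yxi] : exists i, tnth y i != tnth x i.
    apply/not_existsP => h; apply: yx; apply: eq_from_tnth => i.
    by apply/eqP; move/negP: (h i); rewrite negbK.
  exists (Num.truncn `|tnth y i - tnth x i|^-1) => //; exists i.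
  rewrite invf_plt ?posrE ?normr_gt0 ?subr_eq0//.
  exact: truncnS_gt.
have [M FM] := finite_set_nat_bounded finF.
have [_ _ /(_ x (Ux M I))[c Ec xc]] := HU M.
have [m Fm [i]] := EF _ Ec; apply/negP; rewrite -leNgt distrC.
apply: le_trans (ltW (xc i)) _; rewrite lef_pV2 ?posrE// ler_nat ltnS.
exact: FM.
Qed.

(** Local convergence is only given on sets compact in the sense of covers; this allows it to be
    used on cubes. Compactness is transported from products of segments in row vectors. *)
Lemma cube_ecompact (R : realType) (N : nat) (r : R) : ecompact (@cube R N r).
Proof.
move=> I O oO cO.
pose f (v : 'rV[R]_N) : N.-tuple R := [tuple v ord0 i | i < N].
have : compact [set v : 'rV[R]_N | forall i, [set` `[- r, r]] (v ord0 i)].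
  by apply: (rV_compact (A := fun=> [set` `[- r, r]])) => i; exact: segment_compact.
(* [{classic I}] equips the arbitrary index type with the choice structure that finite subcovers
   require. *)
rewrite compact_cover => /(_ {classic I} setT (fun i => f @^-1` O i)) [||D _ Dcov].
- move=> i _; rewrite openE => v /= /oO[s s0 sO].
  (* [N.+1] instead of [N] keeps the radius positive in dimension 0. *)
  apply/nbhs_ballP; exists (s / (2 * N.+1%:R)) => /= [|w vw].
    by rewrite divr_gt0// mulr_gt0.
  apply: sO; apply: (@enorm_lt _ _ _ (s / (2 * N.+1%:R))) => // [|j]; last first.
    rewrite tnth_tsub !tnth_mktuple distrC ltW//.
    exact: (vw.2 ord0 j).
  have N1 : (0 : R) <= N%:R by rewrite ler0n.
  rewrite expr_div_n mulrA ltr_pdivrMr ?exprn_gt0 ?mulr_gt0//.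
  rewrite mulrC ltr_pM2l ?exprn_gt0// -natr1; nra.
- move=> v vr; have : cube r (f v).
    by apply/cubeE => i; rewrite tnth_mktuple ler_norml; have := vr i; rewrite /= in_itv.
  by move=> /cO[i _ Oi]; exists i.
exists ([set` D] : set {classic I}); first by have := @finite_fset {classic I} D; apply.
move=> x /cubeE xr.
have : [set v : 'rV[R]_N | forall i, [set` `[- r, r]] (v ord0 i)] (\row_i tnth x i).
  by move=> i; rewrite mxE /= in_itv/= -ler_norml.
move=> /Dcov[i Di]; exists i => //.
suff <- : f (\row_i tnth x i) = x by [].
by apply: eq_from_tnth => j; rewrite tnth_mktuple mxE.
Qed.

(** * Fatou-type lemmas and completeness of L^p *)

(** No measurability is involved: the integral of a nonnegative function is a supremum over the
    simple functions below it, and this family grows with the function. *)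
Lemma ge0_le_integral_lower d (T : measurableType d) (R : realType)
    (mu : {measure set T -> \bar R}) (f g : T -> \bar R) :
  (forall x, 0 <= f x)%E -> (forall x, f x <= g x)%E ->
  (\int[mu]_x f x <= \int[mu]_x g x)%E.
Proof.
move=> f0 fg; rewrite !ge0_integralTE//; last by move=> x; exact: le_trans (fg x).
apply: ereal_sup_le => _ [h hf <-]; exists h => // x; exact: le_trans (fg x).
Qed.

(* For a non-measurable [f] the integral is a lower integral; this is how the
   liminf over all [t] in [kappa] is handled. *)
Lemma ae_ge0_le_integral_lower d (T : measurableType d) (R : realType)
    (mu : {measure set T -> \bar R}) (f g : T -> \bar R) :
  (forall x, 0 <= f x)%E -> (forall x, 0 <= g x)%E -> measurable_fun setT g ->
  {ae mu, forall x, (f x <= g x)%E} -> (\int[mu]_x f x <= \int[mu]_x g x)%E.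
Proof.
move=> f0 g0 mg [A [mA A0 fgA]].
(* The exceptional set is absorbed by raising [g], whose measurability makes its integral
   insensitive to a null set; [f] is left untouched. *)
pose g' x := if x \in A then +oo%E else g x.
have mg' : measurable_fun setT g'.
  apply: measurable_fun_ifT => //; apply: (measurable_fun_bool true) => //.
  have -> : in_mem^~ (mem A) @^-1` [set true] = A.
    by apply/seteqP; split => x /=; [move=> /set_mem|move=> /mem_set].
  exact: measurableI.
have g'0 x : (0 <= g' x)%E by rewrite /g'; case: ifP.
have -> : (\int[mu]_x g x = \int[mu]_x g' x)%E.
  apply: ge0_ae_eq_integral => //.
  exists A; split => // x /= h; apply: contrapT => nA; apply: h => _.
  by rewrite /g' memNset.
apply: ge0_le_integral_lower => // x; rewrite /g'; case: ifPn => [_|]; first exact: leey.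
rewrite notin_setE => nA; apply: contrapT => h; apply: nA; exact: fgA.
Qed.

Lemma limn_einf_le (R : realType) (u : nat -> \bar R) (c : \bar R) (m : nat) :
  (forall n, (m <= n)%N -> u n <= c)%E -> (limn_einf u <= c)%E.
Proof.
move=> uc; rewrite limn_einf_lim (cvg_lim _ (@cvg_einfs_sup _ u))//.
apply: ge_ereal_sup => _ [n _ <-].
apply: le_trans (uc (maxn m n) (leq_maxl _ _)).
by apply: ereal_inf_lbound; exists (maxn m n) => //=; exact: leq_maxr.
Qed.

Lemma limn_einf_ge (R : realType) (u : nat -> \bar R) (c : \bar R) (m : nat) :
  (forall n, (m <= n)%N -> c <= u n)%E -> (c <= limn_einf u)%E.
Proof.
move=> uc; rewrite limn_einf_lim (cvg_lim _ (@cvg_einfs_sup _ u))//.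
apply: le_trans (ereal_sup_ubound _) => /=; last by exists m.
by apply: le_ereal_inf_tmp => _ [n /= mn <-]; exact: uc.
Qed.

(** Form of Fatou for an integrand [g] that may fail to be measurable and lies below the lower limit
    only almost everywhere. *)
Lemma fatou_le d (T : measurableType d) (R : realType)
    (mu : {measure set T -> \bar R}) (f : nat -> T -> \bar R) (g : T -> \bar R)
    (M : \bar R) (m : nat) :
  (forall x, 0 <= g x)%E -> (forall n x, 0 <= f n x)%E ->
  (forall n, measurable_fun setT (f n)) ->
  {ae mu, forall x, (g x <= limn_einf (f^~ x))%E} ->
  (forall n, (m <= n)%N -> \int[mu]_x f n x <= M)%E -> (\int[mu]_x g x <= M)%E.
Proof.
move=> g0 f0 mf gf fM.
apply: (@le_trans _ _ (\int[mu]_x limn_einf (f^~ x))%E).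
  apply: ae_ge0_le_integral_lower => //.
    by move=> x; apply: (@limn_einf_ge _ _ _ 0) => n _.
  rewrite (_ : (fun _ => _) = (fun x => - limn_esup (fun n => - f n x))%E)//.
  apply: measurableT_comp => //; apply: measurable_fun_limn_esup => n.
  exact: measurableT_comp.
apply: le_trans (fatou _ _ _ _) _ => //; exact: (limn_einf_le fM).
Qed.

(** Borel-Cantelli in integral form: the sum of the [f n] has integral at most 2, so it is finite
    almost everywhere and its terms tend to 0 there. *)
Lemma ae_cvg0 d (T : measurableType d) (R : realType)
    (mu : {measure set T -> \bar R}) (f : nat -> T -> R) :
  (forall n x, 0 <= f n x) -> (forall n, measurable_fun setT (f n)) ->
  (forall n, \int[mu]_x (f n x)%:E <= ((2^-1) ^+ n)%:E)%E ->
  {ae mu, forall x, f n x @[n --> \oo] --> 0}.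
Proof.
move=> f0 mf If.
have mEf n : measurable_fun setT (EFin \o f n) by exact/measurable_EFinP.
have IS : (\int[mu]_x (\sum_(0 <= n <oo) (f n x)%:E) < +oo)%E.
  rewrite integral_nneseries//; last by move=> n x _; rewrite lee_fin.
  apply: (@le_lt_trans _ _ (\sum_(0 <= n <oo) ((2^-1) ^+ n)%:E : \bar R)%E).
    by apply: lee_nneseries => // n _ _; apply: integral_ge0 => x _; rewrite lee_fin.
  apply: (@le_lt_trans _ _ 2%:E); last exact: ltry.
  apply: lime_le; first by apply: is_cvg_nneseries => n _ _; rewrite lee_fin exprn_ge0.
  apply: nearW => n; rewrite sumEFin lee_fin.
  suff -> : \sum_(0 <= i < n) 2^-1 ^+ i = 2 - 2 * 2^-1 ^+ n :> R.
    by rewrite gerBl mulr_ge0// exprn_ge0.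
  elim: n => [|n ih]; first by rewrite big_nil expr0; ring.
  by rewrite big_nat_recr//= ih exprS; field.
have : mu.-integrable setT (fun x => \sum_(0 <= n <oo) (f n x)%:E)%E.
  apply/integrableP; split.
    apply: (ge0_emeasurable_sum (h := fun n x => (f n x)%:E) (P := xpredT)) => //.
      by move=> n x _ _; rewrite lee_fin.
    by move=> n _; exact: mEf.
  rewrite (eq_integral (fun x => \sum_(0 <= n <oo) (f n x)%:E)%E)// => x _.
  by rewrite gee0_abs// nneseries_ge0// => n _ _; rewrite lee_fin.
move/integrable_ae => /(_ measurableT); apply: filterS => x /(_ I) Sx.
apply: cvg_series_cvg_0; apply: nnseries_is_cvg => //.
by move: Sx; rewrite fin_numElt => /andP[].
Qed.

Lemma cvgn_of_geometric_increments (R : realType) (u : nat -> R) (m : nat) :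
  (forall n, (m <= n)%N -> `|u n - u n.+1| <= 2^-1 ^+ n) -> cvgn u.
Proof.
move=> uh; pose w n := u (n + m)%N.
have cw : cvgn (series (telescope w)).
  apply: normed_cvg; apply: (series_le_cvg (v_ := geometric 1 2^-1)) => [n|n|n|].
  - exact: normr_ge0.
  - by rewrite /= mul1r exprn_ge0.
  - rewrite /telescope /= mul1r distrC /w addSn (le_trans (uh _ _)) ?leq_addl//.
    by rewrite ler_wiXn2l ?leq_addr//; lra.
  - by apply: is_cvg_geometric_series; rewrite gtr0_norm//; lra.
have : cvgn w.
  by rewrite (funext (eq_sum_telescope w)); apply: is_cvgD => //; exact: is_cvg_cst.
by move=> /cvg_ex[l wl]; apply/cvg_ex; exists l; rewrite -(cvg_shiftn m).
Qed.

(** For positive [l], continuity comes from derivability of the power; at 0 that argument fails and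
    the threshold e^(1/p) is used directly. *)
Lemma cvg_powR_ge0 (R : realType) (a : nat -> R) (l p : R) : 0 < p ->
  (forall n, 0 <= a n) -> a n @[n --> \oo] --> l -> a n `^ p @[n --> \oo] --> l `^ p.
Proof.
move=> p0 a0 al.
have : 0 <= l.
  by rewrite -(cvg_lim _ al)//; apply: limr_ge; [apply/cvg_ex; exists l|exact: nearW].
rewrite le_eqVlt => /predU1P[l0|l0].
  move: al; rewrite -l0 powR0 ?gt_eqF// => al.
  apply/cvgrPdist_lt => e e0.
  have e1 : 0 < e `^ p^-1 by exact: powR_gt0.
  move/cvgrPdist_lt : al => /(_ _ e1); apply: filterS => n.
  rewrite !sub0r !normrN !ger0_norm ?powR_ge0// => h.
  have := @gt0_ltr_powR _ p p0 _ _ _ _ h; rewrite !nnegrE -powRrM mulVf ?gt_eqF//.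
  by rewrite powRr1 ?(ltW e0)//; apply => //; exact: ltW.
apply: (cvg_comp a (fun x => x `^ p) al).
have /derivable1_diffP/differentiable_continuous : derivable (@powR R ^~ p) l 1; last by [].
by apply: derivable_powR; rewrite in_itv/= andbT.
Qed.

(* The rate makes consecutive differences a.e. eventually at most [2 ^- m]. *)
Lemma Lp_complete_rate d (T : measurableType d) (R : realType)
    (mu : {measure set T -> \bar R}) (D : set T) (u : nat -> T -> R) (p : R) :
  measurable D -> 0 < p -> (forall n, measurable_fun setT (u n)) ->
  (forall m n, (m <= n)%N -> (\int[mu]_(x in D) (`|u m x - u n x| `^ p)%:E <=
      ((2^-1 * (2^-1 `^ p)) ^+ m)%:E)%E) ->
  exists v : T -> R, measurable_fun setT v /\
    forall m, (\int[mu]_(x in D) (`|u m x - v x| `^ p)%:E <=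
      ((2^-1 * (2^-1 `^ p)) ^+ m)%:E)%E.
Proof.
move=> mD p0 mu_ uC.
have mdiff (f g : T -> R) : measurable_fun setT f -> measurable_fun setT g ->
    measurable_fun setT (fun x : T => `|f x - g x| `^ p).
  move=> mf mg; apply: (measurableT_comp (measurable_powR p)).
  by apply: measurableT_comp => //; exact: measurable_funB.
(* [c] is 2^p: multiplying by [c ^+ n] turns the assumed rate into 2^-n, and on [D] the inequality
   [f n x < 1] says that the increment is below 2^-n. *)
pose c : R := (2^-1 `^ p)^-1.
have c0 : 0 < c by rewrite invr_gt0 powR_gt0//.
pose f n x := \1_D x * (c ^+ n * `|u n x - u n.+1 x| `^ p).
have f0 n x : 0 <= f n x by rewrite !mulr_ge0// ?exprn_ge0 ?powR_ge0// ltW.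
have mf n : measurable_fun setT (f n).
  apply: measurable_funM => //; apply: measurable_funM => //; exact: mdiff.
have aef : {ae mu, forall x, f n x @[n --> \oo] --> 0}.
  apply: ae_cvg0 => // n.
  have -> : (\int[mu]_x (f n x)%:E = (c ^+ n)%:E * \int[mu]_(x in D) (`|u n x - u n.+1 x| `^ p)%:E)%E.
    rewrite -ge0_integralZl//; last 2 first.
    - by apply/measurable_funTS/measurable_EFinP; exact: mdiff.
    - by rewrite lee_fin exprn_ge0// ltW.
    rewrite [RHS]integral_mkcond; apply: eq_integral => x _; rewrite /f patchE indicE.
    by case: ifPn; rewrite ?mul1r ?mul0r// EFinM.
  apply: (@le_trans _ _ ((c ^+ n)%:E * ((2^-1 * (2^-1 `^ p)) ^+ n)%:E)%E).
    by rewrite lee_pmul2l ?lte_fin ?exprn_gt0//; exact: uC.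
  by rewrite -EFinM lee_fin exprMn mulrCA -exprMn mulVf ?expr1n ?mulr1// gt_eqF// powR_gt0.
(* The upper limit is measurable whether or not the sequence converges, and it is the limit at
   almost every point of [D]. *)
pose v x := fine (limn_esup (fun n => (u n x)%:E)).
have mv : measurable_fun setT v.
  apply: measurableT_comp => //.
  by apply: measurable_fun_limn_esup => n; exact/measurable_EFinP.
have ucvg : {ae mu, forall x, D x -> u n x @[n --> \oo] --> v x}.
  apply: filterS aef => x fx Dx.
  have : cvgn (u^~ x).
    have /cvgrPdist_lt/(_ 1 ltr01)[m _ fm] := fx.
    apply: (@cvgn_of_geometric_increments _ _ m) => n mn.
    have := fm n mn; rewrite /= sub0r normrN ger0_norm// /f indicE mem_set// mul1r.
    rewrite mulrC -ltr_pdivlMr ?exprn_gt0// mul1r => /ltW h.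
    have h2 : `|u n x - u n.+1 x| `^ p <= (2^-1 ^+ n) `^ p.
      apply: le_trans h _; rewrite -exprVn /c invrK.
      by rewrite -!powR_mulrn ?powR_ge0// powRAC.
    rewrite leNgt; apply/negP => /(@gt0_ltr_powR _ p p0); rewrite !nnegrE => h3.
    by move: h2; rewrite leNgt h3// exprn_ge0.
  move=> cu; rewrite /v.
  have cE : (u n x)%:E @[n --> \oo] --> (limn (u^~ x))%:E by apply: cvg_EFin => //; exact: nearW.
  by have [_ ->] := cvg_limn_einf_sup cE.
exists v; split => // m.
rewrite integral_mkcond.
apply: (@fatou_le _ _ _ _ (fun n x => ((fun x => (`|u m x - u n x| `^ p)%:E) \_ D) x) _ _ m).
- by move=> x; apply: erestrict_ge0 => y _; rewrite lee_fin powR_ge0.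
- by move=> n x; apply: erestrict_ge0 => y _; rewrite lee_fin powR_ge0.
- move=> n; apply: (measurable_restrictT _ mD).1; apply/measurable_funTS/measurable_EFinP; exact: mdiff.
- apply: filterS ucvg => x ux; rewrite patchE; case: ifPn => [|nD].
    rewrite in_setE => /[dup] Dx /ux {}ux.
    have : (`|u m x - u n x| `^ p)%:E @[n --> \oo] --> (`|u m x - v x| `^ p)%:E.
      apply: cvg_EFin; first exact: nearW.
      by apply: cvg_powR_ge0 => //; apply: cvg_norm; apply: cvgB => //; exact: cvg_cst.
    rewrite [X in limn_einf X](_ : _ = fun n => (`|u m x - u n x| `^ p)%:E); last first.
      by apply/funext => n; rewrite /= patchE mem_set.
    by move=> /cvg_limn_einf_sup[-> _].
  by apply: (@limn_einf_ge _ _ _ 0) => n _; rewrite /= patchE (negbTE nD).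
- by move=> n mn; rewrite -integral_mkcond; exact: uC.
Qed.

(** * Precompactness from finite colorings *)

(** An ultrafilter finer than [\oo] replaces nested extractions: each coloring has one class in it,
    and the intersection of finitely many such classes with a tail is still in it, hence inhabited.
    The m-th index is taken in the classes of the colorings 0 to m. *)
Lemma diagonal_subsequence (K : nat -> finType) (c : forall j, nat -> K j) :
  exists phi : nat -> nat, {homo phi : m n / (m < n)%N >-> (m < n)%N} /\
    forall j m n, (j <= m)%N -> (m <= n)%N -> c j (phi m) = c j (phi n).
Proof.
have [G [UG ooG]] := @ultraFilterLemma nat (\oo)%classic _.
have kex : forall j, exists k, G [set n | c j n = k].
  move=> j; apply/not_existsP => h.
  suff : G set0 by exact: filter_not_empty.
  have : \forall n \near G, forall k, c j n <> k.
    apply: filter_forall => k.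
    by have [/h|] := in_ultra_setVsetC [set n | c j n = k] UG.
  by apply: filterS => n /(_ (c j n)).
pose k j := projT1 (cid (kex j)).
have kG j : G [set n | c j n = k j] := projT2 (cid (kex j)).
have nextP m x : exists y, (x < y)%N /\ forall j, (j <= m)%N -> c j y = k j.
  have Gm : G [set y | forall j : 'I_m.+1, c j y = k j].
    by apply: filter_forall => j; exact: kG.
  have Gx : G [set y | (x < y)%N] by apply: ooG; exists x.+1.
  have [y [ym xy]] := filter_ex (filterI Gm Gx).
  exists y; split => // j jm; exact: (ym (Ordinal (jm : (j < m.+1)%N))).
have {nextP}/choice[next nextP] : forall mx : nat * nat, exists y,
    (mx.2 < y)%N /\ forall j, (j <= mx.1)%N -> c j y = k j.
  by move=> [m x]; exact: nextP.
pose phi := fix phi m := if m is m'.+1 then next (m, phi m') else next (0%N, 0%N).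
have phik j m : (j <= m)%N -> c j (phi m) = k j.
  by case: m => [|m] jm; apply: (nextP (_, _)).2.
exists phi; split; last by move=> j m n jm mn; rewrite !phik// (leq_trans jm).
apply: homo_ltn => [x y z|m]; first exact: ltn_trans.
exact: (nextP (_, _)).1.
Qed.

(** Bounding the sum by twice the maximum gives the constant 2^p without convexity. The integrated
    form below serves as triangle inequality for p-th powers. *)
Lemma powR_normD_le (R : realType) (a b p : R) : 0 < p ->
  `|a + b| `^ p <= 2 `^ p * (`|a| `^ p + `|b| `^ p).
Proof.
move=> p0; have p1 := ltW p0.
have h : `|a + b| <= 2 * Num.max `|a| `|b|.
  apply: le_trans (ler_normD _ _) _; rewrite mulr_natl mulr2n lerD// le_max lexx ?orbT//.
apply: (@le_trans _ _ ((2 * Num.max `|a| `|b|) `^ p)).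
  by rewrite ge0_ler_powR ?nnegrE ?mulr_ge0// le_max normr_ge0.
rewrite powRM// ?le_max ?normr_ge0// ler_wpM2l ?powR_ge0//.
by case: (leP `|a| `|b|) => _; rewrite ?lerDl ?lerDr powR_ge0.
Qed.

Lemma measurable_powR_normB d (T : measurableType d) (R : realType) (f g : T -> R) p :
  measurable_fun setT f -> measurable_fun setT g ->
  measurable_fun setT (fun x : T => `|f x - g x| `^ p).
Proof.
move=> mf mg; apply: (measurableT_comp (measurable_powR p)).
by apply: measurableT_comp => //; exact: measurable_funB.
Qed.

Lemma integral_powR_normB_le d (T : measurableType d) (R : realType)
    (mu : {measure set T -> \bar R}) (D : set T) (p : R) (f g h : T -> R) :
  measurable D -> 0 < p -> measurable_fun setT f -> measurable_fun setT g ->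
  measurable_fun setT h ->
  (\int[mu]_(x in D) (`|f x - h x| `^ p)%:E <= (2 `^ p)%:E *
   (\int[mu]_(x in D) (`|f x - g x| `^ p)%:E + \int[mu]_(x in D) (`|g x - h x| `^ p)%:E))%E.
Proof.
move=> mD p0 mf mg mh.
have mE (a b : T -> R) : measurable_fun setT a -> measurable_fun setT b ->
    measurable_fun D (fun x => (`|a x - b x| `^ p)%:E).
  by move=> ma mb; apply/measurable_funTS/measurable_EFinP; exact: measurable_powR_normB.
rewrite -ge0_integralD//; [|exact: mE|exact: mE].
rewrite -ge0_integralZl//; [|by apply: emeasurable_funD; exact: mE|
  by move=> x _; exact: adde_ge0].
apply: ge0_le_integral => //.
- exact: mE.
- apply: emeasurable_funM; first exact: measurable_cst.
  by apply: emeasurable_funD; exact: mE.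
- move=> x _; rewrite -EFinD -EFinM lee_fin.
  by rewrite -(subrKA (g x) (f x)); exact: powR_normD_le.
Qed.

(** One coloring is taken for each scale [q ^+ j], with [q] the ratio required by
    [Lp_complete_rate]. Along the diagonal subsequence, all indices from the j-th on share their
    j-th color, which is exactly the Cauchy rate needed. *)
Lemma precompact_LpE_of_colorings (R : realType) (N : nat)
    (mu : {measure set (N.-tuple R) -> \bar R}) (p : R) (E : set (N.-tuple R))
    (u : nat -> N.-tuple R -> R) :
  measurable E -> 0 < p -> (forall k, measurable_fun setT (u k)) ->
  (forall k, (\int[mu]_(x in E) (`|u k x| `^ p)%:E < +oo)%E) ->
  (forall eta : R, 0 < eta -> exists (K : finType) (c : nat -> K),
     forall m n, c m = c n -> (Lp_distE mu p E (u m) (u n) <= eta%:E)%E) ->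
  precompact_LpE mu p E u.
Proof.
move=> mE p0 mu_ uE uc s.
pose q : R := 2^-1 * (2^-1 `^ p).
have q0 : 0 < q by rewrite mulr_gt0// powR_gt0.
have q1 : `|q| < 1.
  rewrite gtr0_norm// /q; apply: (@le_lt_trans _ _ (2^-1 * 1)); last lra.
  rewrite ler_wpM2l//; apply: le_trans (@ge0_ler_powR _ p (ltW p0) _ 1 _ _ _) _; rewrite ?nnegrE//; first lra.
  by rewrite powR1.
have /choice[K HK] : forall j, exists K : finType, exists c : nat -> K, forall m n, c m = c n ->
    (Lp_distE mu p E (u m) (u n) <= (q ^+ j)%:E)%E.
  by move=> j; apply: uc; rewrite exprn_gt0.
have [c Hc] : exists c : forall j, nat -> K j, forall j m n, c j m = c j n ->
    (Lp_distE mu p E (u m) (u n) <= (q ^+ j)%:E)%E.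
  by exists (fun j => projT1 (cid (HK j))) => j; exact: (projT2 (cid (HK j))).
have [phi [phi_incr phic]] := diagonal_subsequence (fun j n => c j (s n)).
have [|v [mv Hv]] := @Lp_complete_rate _ _ _ mu E (fun n => u (s (phi n))) p mE p0
    (fun n => mu_ (s (phi n))).
  by move=> m n mn; apply: Hc; exact: phic.
exists phi, v; split => //.
  split; first exact: measurable_funTS.
  have mc0 : measurable_fun setT (cst 0 : N.-tuple R -> R) by exact: measurable_cst.
  (* Membership of [v] in L^p(E) follows by comparison with the first term of the subsequence. *)
  have := @integral_powR_normB_le _ _ _ mu E p v (u (s (phi 0%N))) (cst 0) mE p0 mv (mu_ _) mc0.
  under eq_integral do rewrite subr0.
  under [in X in (_ * (_ + X))%E]eq_integral do rewrite subr0.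
  move=> /le_lt_trans; apply.
  rewrite lte_mul_pinfty ?lee_fin ?powR_ge0// lte_add_pinfty//.
  apply: le_lt_trans (ltry (q ^+ 0)).
  by under eq_integral do rewrite distrC; exact: Hv.
apply: (squeeze_cvge _ (cvg_cst 0%E) (h := fun n => (q ^+ n)%:E)).
  apply: nearW => n; apply/andP; split; last exact: Hv.
  by apply: integral_ge0 => x _; rewrite lee_fin powR_ge0.
by apply: cvg_EFin; [exact: nearW|exact: cvg_expr].
Qed.

(** * The energy controls differences at small distance *)

(** Tonelli expects a measure bundled with sigma-finiteness, whereas here this is a proposition
    about a plain measure; the bundle is built locally. *)
Lemma measurable_integral_snd d (T : measurableType d) (R : realType)
    (mu : {measure set T -> \bar R}) (f : T * T -> \bar R) :
  sigma_finite setT mu -> measurable_fun setT f -> (forall z, 0 <= f z)%E ->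
  measurable_fun setT (fun x => \int[mu]_y f (x, y))%E.
Proof.
move=> sf mf f0.
pose H1 := isSFinite.Build _ _ _ _ (sfinite_measure_sigma_finite sf).
pose H2 := isSigmaFinite.Build _ _ _ _ sf.
pose mu' : {sigma_finite_measure set T -> \bar R} :=
  HB.pack_for (SigmaFiniteMeasure.type T R) (Measure.sort mu) H1 H2.
exact: (@measurable_fun_fubini_tonelli_F _ _ _ _ _ mu' f mf f0).
Qed.

Definition near_diff (R : realType) (N : nat) (d p : R) (u : N.-tuple R -> R)
    (z : N.-tuple R * N.-tuple R) : R :=
  \1_(eball0 d) (tsub z.1 z.2) * `|u z.1 - u z.2| `^ p.

Lemma near_diff_ge0 (R : realType) (N : nat) (d p : R) (u : N.-tuple R -> R) z :
  0 <= near_diff d p u z.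
Proof. by rewrite mulr_ge0 ?powR_ge0. Qed.

Lemma measurable_eball0 (R : realType) (N : nat) (d : R) : measurable (@eball0 R N d).
Proof.
rewrite (_ : eball0 d = setT `&` @enorm R N @^-1` `]-oo, d[%classic).
  by apply: measurable_enorm.
by apply/seteqP; split => x /=; rewrite in_itv /=; [|case].
Qed.

Lemma measurable_fun_diff_pow (R : realType) (N : nat) (p : R) (u : N.-tuple R -> R) :
  measurable_fun setT u ->
  measurable_fun setT (fun z : N.-tuple R * N.-tuple R => `|u z.1 - u z.2| `^ p).
Proof.
by move=> mu_; apply: (@measurable_powR_normB _ _ _ (u \o fst) (u \o snd)); exact: measurableT_comp.
Qed.

Lemma measurable_fun_tsub_pair (R : realType) (N : nat) :
  measurable_fun setT (fun z : N.-tuple R * N.-tuple R => tsub z.1 z.2).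
Proof. exact: measurable_tsub. Qed.

Lemma measurable_near_diff (R : realType) (N : nat) (d p : R) (u : N.-tuple R -> R) :
  measurable_fun setT u -> measurable_fun setT (near_diff d p u).
Proof.
move=> mu_; apply: measurable_funM; last exact: measurable_fun_diff_pow.
have mi : measurable_fun setT (\1_(eball0 d) : N.-tuple R -> R).
  by apply: measurable_indic; exact: measurable_eball0.
exact: (measurableT_comp mi (@measurable_fun_tsub_pair R N)).
Qed.

Lemma measurable_fun_slice (R : realType) (N : nat) d (T : measurableType d)
    (f : N.-tuple R * N.-tuple R -> T) x :
  measurable_fun setT f -> measurable_fun setT (fun y => f (x, y)).
Proof. by move=> mf; apply: (measurableT_comp mf); exact: pair1_measurable. Qed.

Lemma measurable_Ftp_integrand (R : realType) (N : nat) (p : R) (r u : N.-tuple R -> R) :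
  measurable_fun setT u -> measurable_fun setT r ->
  measurable_fun setT (fun z : N.-tuple R * N.-tuple R =>
    (`|u z.1 - u z.2| `^ p / (enorm (tsub z.1 z.2)) `^ p) * r (tsub z.1 z.2)).
Proof.
move=> mu_ mr; apply: measurable_funM; last first.
  by apply: (measurableT_comp mr); exact: measurable_fun_tsub_pair.
apply: measurable_funM; first exact: measurable_fun_diff_pow.
rewrite (_ : (fun z => _) = (fun z => enorm (tsub z.1 z.2) `^ (- p))); last first.
  by apply/funext => z; rewrite powRN.
apply: (measurableT_comp (measurable_powR (- p))).
apply: (measurableT_comp (@measurable_enorm R N)); exact: measurable_fun_tsub_pair.
Qed.

(** The lower bound on [rho s] holds for almost every z. For each fixed x, the reflection y -> x - y
    carries it to almost every y, so the comparison takes place in the inner integral. *)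
Lemma near_diff_le_Ftp (R : realType) (N : nat)
    (mu : {measure set (N.-tuple R) -> \bar R}) (p : R)
    (rho : R -> N.-tuple R -> R) (s d c : R) (u : N.-tuple R -> R) :
  is_lebesgue_measure mu -> 0 <= c -> measurable_fun setT u ->
  measurable_fun setT (rho s) -> (forall z, 0 <= rho s z) ->
  {ae mu, forall z, eball0 d z -> c <= rho s z / (enorm z) `^ p} ->
  (c%:E * \int[mu]_x \int[mu]_y (near_diff d p u (x, y))%:E <= Ftp mu rho s p u)%E.
Proof.
move=> muL c0 mu_ mrho rho0 cae; have sf := lebesgue_sigma_finite muL.
have mnd := measurable_near_diff d p mu_.
have mI : measurable_fun setT (fun x => \int[mu]_y (near_diff d p u (x, y))%:E)%E.
  apply: (@measurable_integral_snd _ _ _ _ (EFin \o near_diff d p u)) => //.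
    exact/measurable_EFinP.
  by move=> z; rewrite lee_fin near_diff_ge0.
pose F z := ((`|u z.1 - u z.2| `^ p / (enorm (tsub z.1 z.2)) `^ p) * rho s (tsub z.1 z.2)).
have F0 z : 0 <= F z by rewrite !mulr_ge0 ?powR_ge0// invr_ge0 powR_ge0.
have mF : measurable_fun setT F by exact: measurable_Ftp_integrand.
rewrite -ge0_integralZl//; last first.
  by move=> x _; apply: integral_ge0 => y _; rewrite lee_fin near_diff_ge0.
apply: ge0_le_integral => //.
- move=> x _; apply: mule_ge0; first by rewrite lee_fin.
  by apply: integral_ge0 => y _; rewrite lee_fin near_diff_ge0.
- exact: measurable_funeM.
- apply: (@measurable_integral_snd _ _ _ _ (EFin \o F)) => //.
  exact/measurable_EFinP.
move=> x _; rewrite -ge0_integralZl//; last 2 first.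
  - by apply/measurable_EFinP; exact: (measurable_fun_slice x mnd).
  - by move=> y _; rewrite lee_fin near_diff_ge0.
apply: ae_ge0_le_integral => //.
- by move=> y _; rewrite mule_ge0// lee_fin// near_diff_ge0.
- apply: measurable_funeM; apply/measurable_EFinP; exact: (measurable_fun_slice x mnd).
- by move=> y _; rewrite lee_fin; exact: (F0 (x, y)).
- by apply/measurable_EFinP; exact: (measurable_fun_slice x mF).
apply: filterS (lebesgue_negligible_tsub muL x cae) => y cy _.
rewrite -EFinM lee_fin /near_diff indicE /=.
case: (boolP (tsub x y \in eball0 d)) => [/set_mem/cy h|_]; last first.
  by rewrite mul0r mulr0; exact: (F0 (x, y)).
rewrite mul1r mulrC -mulrA ler_wpM2l ?powR_ge0//.
by rewrite mulrC.
Qed.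

(** * Cubes and step functions *)

(** Each coordinate has 2L+1 corners, from -hL to hL. The last one is there because cells are
    half-open: without it the face at hL of the closed cube would be missed. *)
Definition cell_corner (R : realType) (N L : nat) (h : R)
    (q : {ffun 'I_N -> 'I_L.*2.+1}) (i : 'I_N) : R := h * ((q i)%:R - L%:R).

Definition cell (R : realType) (N L : nat) (h : R) (q : {ffun 'I_N -> 'I_L.*2.+1}) :
    set (N.-tuple R) :=
  [set x | forall i, cell_corner h q i <= tnth x i < cell_corner h q i + h].

Lemma measurable_cell (R : realType) (N L : nat) (h : R)
  (q : {ffun 'I_N -> 'I_L.*2.+1}) : measurable (cell h q).
Proof.
pose A i := [set` `[cell_corner h q i, cell_corner h q i + h[].
rewrite (_ : cell h q = [set x | forall i, A i (tnth x i)]).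
  by apply: measurable_forall_tnth => i; exact: measurable_itv.
by apply/seteqP; split => x xab i; move: (xab i); rewrite /A /= in_itv.
Qed.

Lemma cell_disjoint (R : realType) (N L : nat) (h : R)
    (q q' : {ffun 'I_N -> 'I_L.*2.+1}) x :
  0 < h -> cell h q x -> cell h q' x -> q = q'.
Proof.
move=> h0 xq xq'; apply/ffunP => i; apply/val_inj/eqP.
have /andP[a1 a2] := xq i; have /andP[b1 b2] := xq' i.
have key (m n : nat) : h * (m%:R - L%:R) < h * (n%:R - L%:R) + h -> (m <= n)%N.
  rewrite -{3}(mulr1 h) -mulrDr ltr_pM2l// => mn.
  by rewrite -ltnS -(ltr_nat R) -natr1; lra.
by rewrite eqn_leq !key//; [exact: le_lt_trans b1 a2|exact: le_lt_trans a1 b2].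
Qed.

Lemma cube_sub_cells (R : realType) (N L : nat) (h r : R) (x : N.-tuple R) :
  0 < h -> r <= h * L%:R -> cube r x ->
  exists q : {ffun 'I_N -> 'I_L.*2.+1}, cell h q x.
Proof.
move=> h0 rL /cubeE xr.
have xh i : 0 <= tnth x i / h + L%:R <= L.*2%:R.
  have : - L%:R <= tnth x i / h <= L%:R.
    rewrite ler_pdivlMr// ler_pdivrMr// mulNr -ler_norml mulrC.
    exact: le_trans (xr i) rL.
  by rewrite -addnn natrD => /andP[]; lra.
have qlt i : (Num.truncn (tnth x i / h + L%:R)%R < L.*2.+1)%N.
  have /andP[h1 h2] := xh i.
  by rewrite ltnS -(ler_nat R) (le_trans _ h2)// truncn_le.
exists [ffun i => Ordinal (qlt i)] => i.
have /andP[h1 h2] := xh i; rewrite /cell_corner ffunE /=.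
have := truncn_itv h1; set m := Num.truncn _ => /andP[m1 m2].
have xE : tnth x i = h * (tnth x i / h) by field; rewrite gt_eqF.
rewrite -natr1 in m2.
have : h * (m%:R - L%:R) <= h * (tnth x i / h) by rewrite ler_pM2l//; lra.
have : h * (tnth x i / h) < h * (m%:R - L%:R + 1) by rewrite ltr_pM2l//; lra.
by rewrite -xE; lra.
Qed.

(** A half-open cell is squeezed between closed boxes of sides h/2 and h. The lost factor 2^N only
    affects constants and spares the exact measure. *)
Lemma cell_measure_ge (R : realType) (N L : nat) (mu : {measure set (N.-tuple R) -> \bar R})
    (h : R) (q : {ffun 'I_N -> 'I_L.*2.+1}) :
  is_lebesgue_measure mu -> 0 < h -> (((h / 2) ^+ N)%:E <= mu (cell h q))%E.
Proof.
move=> muL h0.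
pose a := [tuple cell_corner h q i | i < N].
pose b := [tuple cell_corner h q i + h / 2 | i < N].
have -> : ((h / 2) ^+ N)%:E = mu (box a b).
  rewrite muL => [|i]; last by rewrite !tnth_mktuple; lra.
  congr EFin; rewrite -[in LHS](card_ord N) -prodr_const.
  by apply: eq_bigr => i _; rewrite !tnth_mktuple; ring.
rewrite le_measure// ?inE; [exact: measurable_box|exact: measurable_cell|].
by move=> x xab i; have := xab i; rewrite !tnth_mktuple; lra.
Qed.

Lemma cell_measure_le (R : realType) (N L : nat) (mu : {measure set (N.-tuple R) -> \bar R})
    (h : R) (q : {ffun 'I_N -> 'I_L.*2.+1}) :
  is_lebesgue_measure mu -> 0 < h -> (mu (cell h q) <= (h ^+ N)%:E)%E.
Proof.
move=> muL h0.
pose a := [tuple cell_corner h q i | i < N].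
pose b := [tuple cell_corner h q i + h | i < N].
have -> : (h ^+ N)%:E = mu (box a b).
  rewrite muL => [|i]; last by rewrite !tnth_mktuple; lra.
  congr EFin; rewrite -[in LHS](card_ord N) -prodr_const.
  by apply: eq_bigr => i _; rewrite !tnth_mktuple; ring.
rewrite le_measure// ?inE; [exact: measurable_cell|exact: measurable_box|].
by move=> x xab i; have := xab i; rewrite !tnth_mktuple; lra.
Qed.

(** If every point of Q failed, integrating would give a' w <= w a. The gap a < a' makes this
    contradictory even when a = 0. *)
Lemma exists_le_average d (T : measurableType d) (R : realType)
    (mu : {measure set T -> \bar R}) (Q : set T) (g : T -> \bar R) (w a a' : R) :
  measurable Q -> measurable_fun setT g -> (forall x, 0 <= g x)%E ->
  0 < w -> (w%:E <= mu Q)%E -> 0 <= a -> a < a' ->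
  (\int[mu]_(x in Q) g x <= a%:E)%E ->
  exists2 y, Q y & (w%:E * g y <= a'%:E)%E.
Proof.
move=> mQ mg g0 w0 wQ a0 aa' ga; apply: contrapT => hn.
have h y : Q y -> (a'%:E <= w%:E * g y)%E.
  by move=> Qy; rewrite leNgt; apply/negP => /ltW gy; apply: hn; exists y.
have : (\int[mu]_(x in Q) a'%:E <= \int[mu]_(x in Q) (w%:E * g x))%E.
  apply: ge0_le_integral => //.
  - by move=> x _; rewrite lee_fin (le_trans a0)// ltW.
  - by apply: measurable_funeM; exact: measurable_funTS.
rewrite integral_cst// ge0_integralZl//; last 2 first.
  - exact: measurable_funTS.
  - by rewrite lee_fin ltW.
apply/negP; rewrite -ltNge.
apply: (@le_lt_trans _ _ (w%:E * a%:E)%E); first by rewrite lee_pmul2l.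
apply: (@lt_le_trans _ _ (a'%:E * w%:E)%E).
  by rewrite -!EFinM lte_fin mulrC ltr_pM2r.
by rewrite lee_pmul2l// lte_fin (le_lt_trans a0).
Qed.

(** Cells are disjoint, so a pair (y, x) is counted at most once, and side d/(2N) forces two points
    of one cell to be at distance less than d. *)
Lemma integral_cell_pairs_le (R : realType) (N L : nat)
    (mu : {measure set (N.-tuple R) -> \bar R}) (h d p : R) (u : N.-tuple R -> R) :
  is_lebesgue_measure mu -> (0 < N)%N -> 0 < d -> h = d / (2 * N%:R) ->
  measurable_fun setT u ->
  (\sum_(q : {ffun 'I_N -> 'I_L.*2.+1}) \int[mu]_(y in cell h q)
     \int[mu]_(x in cell h q) (`|u y - u x| `^ p)%:E <=
   \int[mu]_x \int[mu]_y (near_diff d p u (x, y))%:E)%E.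
Proof.
move=> muL N0 d0 hE mu_; have sf := lebesgue_sigma_finite muL.
have h0 : 0 < h by rewrite hE divr_gt0// mulr_gt0// ltr0n.
pose phi (q : {ffun 'I_N -> 'I_L.*2.+1}) (z : N.-tuple R * N.-tuple R) : R :=
  \1_(cell h q) z.1 * (\1_(cell h q) z.2 * `|u z.1 - u z.2| `^ p).
have phi0 q z : 0 <= phi q z by rewrite !mulr_ge0 ?powR_ge0.
have mi q : measurable_fun setT (\1_(cell h q) : N.-tuple R -> R).
  by apply: measurable_indic; exact: measurable_cell.
have mphi q : measurable_fun setT (phi q).
  have mi1 : measurable_fun setT ((\1_(cell h q) : N.-tuple R -> R) \o
    (fst : N.-tuple R * N.-tuple R -> _)) by exact: measurableT_comp.
  have mi2 : measurable_fun setT ((\1_(cell h q) : N.-tuple R -> R) \o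
    (snd : N.-tuple R * N.-tuple R -> _)) by exact: measurableT_comp.
  apply: measurable_funM; first exact: mi1.
  apply: measurable_funM; first exact: mi2.
  exact: measurable_fun_diff_pow.
have mE (f : N.-tuple R * N.-tuple R -> R) : measurable_fun setT f -> (forall z, 0 <= f z) ->
    measurable_fun setT (fun x => \int[mu]_y (f (x, y))%:E)%E.
  move=> mf f0; apply: (@measurable_integral_snd _ _ _ _ (EFin \o f)) => //.
  exact/measurable_EFinP.
have mEx (f : N.-tuple R * N.-tuple R -> R) x : measurable_fun setT f ->
    measurable_fun setT (fun y => (f (x, y))%:E)%E.
  by move=> mf; apply/measurable_EFinP; exact: (measurable_fun_slice x mf).
rewrite (eq_bigr (fun q => \int[mu]_y \int[mu]_x (phi q (y, x))%:E)%E); last first.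
  move=> q _; rewrite integral_mkcond; apply: eq_integral => y _; rewrite patchE /phi /= indicE.
  case: ifPn => _; last first.
    by rewrite integral0_eq// => x _; rewrite mul0r.
  rewrite integral_mkcond; apply: eq_integral => x _; rewrite patchE indicE mul1r.
  by case: ifPn => _; rewrite ?mul1r ?mul0r.
rewrite -ge0_integral_sum//; last 2 first.
- by move=> q; exact: mE.
- by move=> q y _; apply: integral_ge0 => x _; rewrite lee_fin.
apply: ge0_le_integral => //.
- by move=> y _; apply: sume_ge0 => q _; apply: integral_ge0 => x _; rewrite lee_fin.
- by apply: emeasurable_sum => q; exact: mE.
- by apply: mE; [exact: measurable_near_diff|exact: near_diff_ge0].
move=> y _; rewrite -ge0_integral_sum//; last 2 first.
- by move=> q; exact: mEx.
- by move=> q x _; rewrite lee_fin.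
apply: ge0_le_integral => //.
- by move=> x _; apply: sume_ge0 => q _; rewrite lee_fin.
- by apply: emeasurable_sum => q; exact: mEx.
- by apply: mEx; exact: measurable_near_diff.
move=> x _; rewrite sumEFin lee_fin.
have [[q [yq xq]]|nq] := pselect (exists q : {ffun 'I_N -> 'I_L.*2.+1}, cell h q y /\ cell h q x).
  rewrite (bigD1 q)//= big1 ?addr0 => [|q' q'q]; last first.
    rewrite /phi /= indicE; case: (boolP (y \in cell h q')) => [/set_mem yq'|_]; last by rewrite mul0r.
    by move: q'q; rewrite (cell_disjoint h0 yq' yq) eqxx.
  rewrite /phi /near_diff /= !indicE !mem_set ?mul1r//=.
  apply: enorm_lt_div => // i; rewrite tnth_tsub -hE ler_norml.
  by have := yq i; have := xq i; lra.
rewrite big1 ?near_diff_ge0// => q _; rewrite /phi /= !indicE.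
case: (boolP (y \in _)) => [/set_mem yq|_]; last by rewrite mul0r.
case: (boolP (x \in _)) => [/set_mem xq|_]; last by rewrite mul0r mulr0.
by exfalso; apply: nq; exists q.
Qed.

(* The constant on each cell is a well chosen value of [u] rather than its mean,
   which makes Jensen's inequality unnecessary. *)
Lemma step_approximation (R : realType) (N L : nat)
    (mu : {measure set (N.-tuple R) -> \bar R}) (h d p S S' : R) (u : N.-tuple R -> R) :
  is_lebesgue_measure mu -> (0 < N)%N -> 0 < d -> h = d / (2 * N%:R) ->
  measurable_fun setT u -> S < S' ->
  (\int[mu]_x \int[mu]_y (near_diff d p u (x, y))%:E <= S%:E)%E ->
  exists c : {ffun 'I_N -> 'I_L.*2.+1} -> R,
    (((h / 2) ^+ N)%:E *
       \sum_q \int[mu]_(x in cell h q) (`|u x - c q| `^ p)%:E <= S'%:E)%E.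
Proof.
move=> muL N0 d0 hE mu_ SS' ndS; have sf := lebesgue_sigma_finite muL.
have h0 : 0 < h by rewrite hE divr_gt0// mulr_gt0// ltr0n.
have w0 : 0 < (h / 2) ^+ N by rewrite exprn_gt0// divr_gt0.
pose I := {ffun 'I_N -> 'I_L.*2.+1}.
pose G (q : I) y : \bar R := (\int[mu]_(x in cell h q) (`|u y - u x| `^ p)%:E)%E.
pose A q : \bar R := (\int[mu]_(y in cell h q) G q y)%E.
have G0 q y : (0 <= G q y)%E by apply: integral_ge0 => x _; rewrite lee_fin powR_ge0.
have A0 q : (0 <= A q)%E by apply: integral_ge0 => x _.
have mG q : measurable_fun setT (G q).
  rewrite (_ : G q = fun y => \int[mu]_x (\1_(cell h q) x * `|u y - u x| `^ p)%:E)%E.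
    pose f (z : N.-tuple R * N.-tuple R) := \1_(cell h q) z.2 * `|u z.1 - u z.2| `^ p.
    apply: (@measurable_integral_snd _ _ _ _ (EFin \o f)) => //; last first.
      by move=> z; rewrite lee_fin mulr_ge0 ?powR_ge0.
    apply/measurable_EFinP/measurable_funM; last exact: measurable_fun_diff_pow.
    have mi : measurable_fun setT (\1_(cell h q) : N.-tuple R -> R).
      by apply: measurable_indic; exact: measurable_cell.
    have mi2 : measurable_fun setT ((\1_(cell h q) : N.-tuple R -> R) \o
      (snd : N.-tuple R * N.-tuple R -> _)) by exact: measurableT_comp.
    exact: mi2.
  apply/funext => y; rewrite /G integral_mkcond; apply: eq_integral => x _.
  by rewrite patchE indicE; case: ifPn => _; rewrite ?mul1r ?mul0r.
have AS : (\sum_q A q <= S%:E)%E.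
  by apply: le_trans ndS; exact: integral_cell_pairs_le.
have Afin q : A q \is a fin_num.
  rewrite ge0_fin_numE//; apply: le_lt_trans (ltry S); apply: le_trans AS.
  by rewrite (bigD1 q)//= leeDl// sume_ge0.
have cardI : (0 : R) < #|I|%:R.
  by rewrite ltr0n; apply/card_gt0P; exists [ffun=> ord0].
(* The slack S' - S is shared equally among the cells, each choice of a value costing [tau]. *)
pose tau := (S' - S) / #|I|%:R.
have tau0 : 0 < tau by rewrite divr_gt0// subr_gt0.
have /choice[y Hy] : forall q : I, exists y,
    (((h / 2) ^+ N)%:E * G q y <= (fine (A q) + tau)%:E)%E.
  move=> q.
  have [||||y _ Gy] := @exists_le_average _ _ _ mu (cell h q) (G q) ((h / 2) ^+ N)
      (fine (A q)) (fine (A q) + tau) (measurable_cell _ _) (mG q) (G0 q) w0.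
  - exact: cell_measure_ge.
  - exact: fine_ge0.
  - by rewrite ltrDl.
  - by rewrite fineK.
  - by exists y.
exists (fun q => u (y q)).
rewrite ge0_sume_distrr; last first.
  by move=> q _; apply: integral_ge0 => x _; rewrite lee_fin powR_ge0.
apply: (@le_trans _ _ (\sum_q (fine (A q) + tau)%:E)%E).
  apply: lee_sum => q _; under eq_integral do rewrite distrC; exact: Hy.
rewrite (eq_bigr (fun q => A q + tau%:E)%E) => [|q _]; last by rewrite EFinD fineK.
rewrite big_split/= [X in (_ + X)%E]sumEFin sumr_const -mulr_natr divfK ?gt_eqF//.
by apply: (@le_trans _ _ (S%:E + (S' - S)%:E)%E); [rewrite leeD2r|rewrite -EFinD subrKC].
Qed.

(** * Colorings by quantized step functions *)

Lemma bounded_coloring (R : realType) (I : finType) (a : nat -> I -> R) (B tau : R) :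
  0 < tau -> (forall k i, `|a k i| <= B) ->
  exists (K : finType) (c : nat -> K),
    forall m n, c m = c n -> forall i, `|a m i - a n i| <= tau.
Proof.
(* Values are shifted from [-B, B] to [0, 2B] and rounded down to multiples of [tau]; the colors are
   the quotients 0 to L. *)
move=> tau0 aB; pose L := Num.truncn (2 * B / tau).
pose f k i := Num.truncn ((a k i + B) / tau).
have aB0 k i : 0 <= (a k i + B) / tau.
  by rewrite divr_ge0 ?(ltW tau0)//; have := aB k i; rewrite ler_norml; lra.
have fL k i : (f k i < L.+1)%N.
  rewrite ltnS; apply: le_truncn; rewrite ler_pM2r ?invr_gt0//.
  by have := aB k i; rewrite ler_norml; lra.
exists {ffun I -> 'I_L.+1}, (fun k => [ffun i => Ordinal (fL k i)]).
move=> m n /ffunP mn i; have := congr1 val (mn i); rewrite !ffunE /= => fmn.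
have := truncn_itv (aB0 m i); have := truncn_itv (aB0 n i).
rewrite -/(f m i) -/(f n i) fmn -natr1 !ler_pdivlMr// !ltr_pdivrMr// mulrDl mul1r.
by move=> /andP[h1 h2] /andP[h3 h4]; rewrite ler_distl; apply/andP; split; lra.
Qed.

Lemma Lp_distE_cells_le (R : realType) (N L : nat)
    (mu : {measure set (N.-tuple R) -> \bar R}) (h p r : R) (E : set (N.-tuple R))
    (u v : N.-tuple R -> R) :
  measurable E -> E `<=` cube r -> 0 < h -> r <= h * L%:R ->
  measurable_fun setT u -> measurable_fun setT v ->
  (Lp_distE mu p E u v <=
   \sum_(q : {ffun 'I_N -> 'I_L.*2.+1}) \int[mu]_(x in cell h q) (`|u x - v x| `^ p)%:E)%E.
Proof.
move=> mE Er h0 rL mu_ mv.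
pose g x := (`|u x - v x| `^ p)%:E.
have mg D : measurable_fun D g.
  by apply/measurable_funTS/measurable_EFinP; exact: measurable_powR_normB.
have g0 x : (0 <= g x)%E by rewrite lee_fin powR_ge0.
have mr D : measurable D -> measurable_fun setT (g \_ D).
  by move=> mD; apply: (measurable_restrictT _ mD).1.
rewrite /Lp_distE integral_mkcond.
rewrite (eq_bigr (fun q => \int[mu]_x (g \_ (cell h q)) x)%E); last first.
  by move=> q _; rewrite integral_mkcond.
rewrite -ge0_integral_sum//; last 2 first.
- by move=> q; apply: mr; exact: measurable_cell.
- by move=> q x _; exact: erestrict_ge0.
apply: ge0_le_integral => //.
- by move=> x _; exact: erestrict_ge0.
- exact: mr.
- by apply: emeasurable_sum => q; apply: mr; exact: measurable_cell.
move=> x _; rewrite patchE; case: ifPn => [/set_mem/Er xr|_]; last first.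
  by apply: sume_ge0 => q _; exact: erestrict_ge0.
have [q xq] := cube_sub_cells h0 rL xr.
rewrite (bigD1 q)//= patchE mem_set// leeDl// sume_ge0// => q' _.
exact: erestrict_ge0.
Qed.

(** The color of k is the rounded list of cell values of a step function close to u_k, together with
    k itself when t_k is not yet known to be below delta. *)
Lemma Lp_colorings (R : realType) (N : nat)
    (mu : {measure set (N.-tuple R) -> \bar R}) (p : R) (rho : R -> N.-tuple R -> R)
    (t : nat -> R) (u : nat -> N.-tuple R -> R) (B M eta : R) (E : set (N.-tuple R)) :
  (0 < N)%N -> is_lebesgue_measure mu -> 0 < p ->
  (forall s, 0 < s < 1 -> measurable_fun setT (rho s)) ->
  (forall s, 0 < s < 1 -> forall z, 0 <= rho s z) ->
  (forall eps, 0 < eps -> exists delta : R, 0 < delta /\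
     forall s, 0 < s < delta ->
       {ae mu, forall z, eball0 delta z ->
          1 / (eps * delta ^+ N) <= rho s z / (enorm z) `^ p}) ->
  (forall k, 0 < t k < 1) -> t @ \oo --> (0:R) ->
  (forall k, measurable_fun setT (u k)) ->
  (forall k, (\int[mu]_x (`|u k x| `^ p)%:E <= B%:E)%E) ->
  0 < M -> (forall k, (Ftp mu rho (t k) p (u k) <= M%:E)%E) ->
  ecompact E -> 0 < eta ->
  exists (K : finType) (c : nat -> K),
    forall m n, c m = c n -> (Lp_distE mu p E (u m) (u n) <= eta%:E)%E.
Proof.
move=> N0 muL p0 mrho rho0 hrho t01 t0 mu_ uB M0 uM cE eta0.
have B0 : 0 <= B.
  rewrite -lee_fin; apply: le_trans (uB 0%N).
  by apply: integral_ge0 => x _; rewrite lee_fin powR_ge0.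
have NR0 : (0 : R) < N%:R by rewrite ltr0n.
pose P : R := 2 `^ p; have P0 : 0 < P by rewrite powR_gt0.
(* Passing from u_m to u_n goes through both step functions; the two approximations and the rounding
   cost D each, for a total of P (D + P (D + D)) = eta. *)
pose D := eta / (P * (1 + 2 * P)).
have D0 : 0 < D by rewrite divr_gt0// mulr_gt0// addr_gt0// mulr_gt0.
(* Solves M eps d^N = w D / 2 with w = (d/(4N))^N; the factor 1/2 leaves the strict gap that
   [step_approximation] asks for. *)
pose eps := D / (2 * M * (4 * N%:R) ^+ N).
have eps0 : 0 < eps by rewrite divr_gt0// !mulr_gt0// exprn_gt0// mulr_gt0.
have [d [d0 dae]] := hrho eps eps0.
pose h := d / (2 * N%:R).
have h0 : 0 < h by rewrite divr_gt0// mulr_gt0.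
pose w := (h / 2) ^+ N; have w0 : 0 < w by rewrite exprn_gt0// divr_gt0.
have mE := ecompact_measurable cE.
have [r Er] := ecompact_bounded cE.
pose L := (Num.truncn (r%:R / h)).+1.
have rL : r%:R <= h * L%:R by rewrite mulrC -ler_pdivrMr// ltW// truncnS_gt.
pose I := {ffun 'I_N -> 'I_L.*2.+1}.
have cardI : (0 : R) < #|I|%:R.
  by rewrite ltr0n; apply/card_gt0P; exists [ffun=> ord0].
have [k0 hk0] : exists k0, forall k, (k0 <= k)%N -> t k < d.
  have /cvgrPdist_lt/(_ _ d0)[k0 _ hk] := t0; exists k0 => k /hk /=.
  by rewrite sub0r normrN gtr0_norm//; have /andP[] := t01 k.
pose err (f : N.-tuple R -> R) (a : I -> R) : \bar R :=
  (\sum_q \int[mu]_(x in cell h q) (`|f x - a q| `^ p)%:E)%E.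
have step k : (k0 <= k)%N -> exists a : I -> R, (err (u k) a <= D%:E)%E.
  move=> kk.
  have wD : w * D / 2 < w * D by have := mulr_gt0 w0 D0; lra.
  have [|a Ha] := step_approximation L muL N0 d0 (erefl : h = _) (mu_ k) wD (p := p).
    have /andP[tk0 tk1] := t01 k.
    have tkd : 0 < t k < d by rewrite tk0 hk0.
    have c0 : 0 < 1 / (eps * d ^+ N) by rewrite divr_gt0// mulr_gt0// exprn_gt0.
    have := near_diff_le_Ftp muL (ltW c0) (mu_ k) (mrho _ (t01 k)) (rho0 _ (t01 k)) (dae _ tkd).
    move=> /le_trans /(_ (uM k)).
    have -> : M%:E = ((1 / (eps * d ^+ N))%:E * (w * D / 2)%:E)%E.
      rewrite -EFinM /eps /w /h; congr EFin.
      rewrite (_ : d / (2 * N%:R) / 2 = d / (4 * N%:R)); last by field; rewrite gt_eqF.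
      rewrite expr_div_n; field.
      by rewrite ?gt_eqF ?exprn_gt0// mulr_gt0.
    by rewrite lee_pmul2l// lte_fin.
  by exists a; move: Ha; rewrite EFinM lee_pmul2l// lte_fin.
(* The cell values are values of u_k at chosen points, with no a priori bound. Integrating the
   constant a_q over its cell gives |a_q|^p w <= P (D + B). *)
pose X := P * (D + B) / w.
have mcst (a : R) : measurable_fun setT (cst a : N.-tuple R -> R) by exact: measurable_cst.
have int_ge0 (A : set (N.-tuple R)) (g : N.-tuple R -> R) : (0 <= \int[mu]_(x in A) (`|g x| `^ p)%:E)%E.
  by apply: integral_ge0 => x _; rewrite lee_fin powR_ge0.
have err_bound k a : (err (u k) a <= D%:E)%E -> forall q, `|a q| <= X `^ p^-1.
  move=> aD q; rewrite -[leLHS](powRr1 (normr_ge0 (a q))) -(mulfV (lt0r_neq0 p0)) powRrM.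
  rewrite ge0_ler_powR ?nnegrE ?invr_ge0 ?(ltW p0) ?powR_ge0//.
    by rewrite divr_ge0 ?(ltW w0)// mulr_ge0 ?(ltW P0)// addr_ge0// ltW.
  rewrite ler_pdivlMr// -lee_fin EFinM.
  apply: (@le_trans _ _ ((`|a q| `^ p)%:E * mu (cell h q))%E).
    by rewrite lee_wpmul2l ?lee_fin ?powR_ge0//; exact: cell_measure_ge.
  rewrite -integral_cst; last exact: measurable_cell.
  have := @integral_powR_normB_le _ _ _ mu (cell h q) p (cst (a q)) (u k) (cst 0)
    (measurable_cell _ _) p0 (mcst _) (mu_ k) (mcst _).
  under eq_integral do rewrite subr0.
  move=> /le_trans; apply; rewrite EFinM lee_pmul2l// EFinD leeD//.
    under eq_integral do rewrite distrC.
    apply: le_trans aD; rewrite /err (bigD1 q)//= leeDl//; apply: sume_ge0 => q' _.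
    exact: (int_ge0 (cell h q') (fun x => u k x - a q')).
  apply: le_trans (uB k); under eq_integral do rewrite subr0.
  apply: ge0_subset_integral => //; first exact: measurable_cell.
  apply/measurable_EFinP; apply: (measurableT_comp (measurable_powR p)).
  exact: measurableT_comp.
have /choice[a Ha] : forall k, exists a : I -> R,
    (forall q, `|a q| <= X `^ p^-1) /\ ((k0 <= k)%N -> (err (u k) a <= D%:E)%E).
  move=> k; case: (leqP k0 k) => kk.
    by have [a aD] := step k kk; exists a; split => // q; exact: err_bound aD q.
  (* Placeholder for the early indices: it only has to satisfy the uniform bound. *)
  by exists (fun=> 0); split => // q; rewrite normr0 powR_ge0.
(* Rounding costs at most tau^p h^N = D / #|I| on each cell, hence D in total. *)
pose tau := (D / (#|I|%:R * h ^+ N)) `^ p^-1.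
have tau0 : 0 < tau by rewrite powR_gt0// divr_gt0// mulr_gt0// exprn_gt0.
have [K [c Hc]] := bounded_coloring tau0 (fun k q => (Ha k).1 q).
(* [insub k] is [Some] of k below k0 and [None] from k0 on, so equal colors force either m = n or
   both indices in the controlled range. *)
exists (option 'I_k0 * K)%type, (fun k => (insub k : option 'I_k0, c k)) => m n [].
case: insubP => [i im iE|]; last first.
  rewrite -leqNgt => km; case: insubP => //; rewrite -leqNgt => kn _ mn.
  apply: le_trans (Lp_distE_cells_le mu p mE Er h0 rL (mu_ m) (mu_ n)) _.
  pose e (f : N.-tuple R -> R) (b : I -> R) q : \bar R :=
    (\int[mu]_(x in cell h q) (`|f x - b q| `^ p)%:E)%E.
  have e0 f b q : (0 <= e f b q)%E by exact: (int_ge0 (cell h q) (fun x => f x - b q)).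
  apply: (@le_trans _ _
    (\sum_q P%:E * (e (u m) (a m) q + P%:E * ((D / #|I|%:R)%:E + e (u n) (a n) q)))%E).
    apply: lee_sum => q _.
    have mq := measurable_cell h q.
    apply: le_trans (integral_powR_normB_le mu mq p0 (mu_ m) (mcst (a m q)) (mu_ n)) _.
    rewrite lee_pmul2l// leeD2l//.
    apply: le_trans (integral_powR_normB_le mu mq p0 (mcst (a m q)) (mcst (a n q)) (mu_ n)) _.
    rewrite lee_pmul2l// leeD//; last by rewrite /e; under eq_integral do rewrite distrC.
    have -> : (\int[mu]_(x in cell h q) (`|cst (a m q) x - cst (a n q) x| `^ p)%:E =
        (`|a m q - a n q| `^ p)%:E * mu (cell h q))%E by rewrite -integral_cst.
    apply: (@le_trans _ _ ((tau `^ p)%:E * (h ^+ N)%:E)%E).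
      apply: lee_pmul => //.
        by rewrite lee_fin ge0_ler_powR ?nnegrE ?(ltW p0) ?(ltW tau0)//; exact: Hc.
      exact: cell_measure_le.
    rewrite -EFinM lee_fin -powRrM mulVf ?gt_eqF// powRr1; last first.
      by rewrite divr_ge0 ?(ltW D0)// mulr_ge0 ?(ltW cardI)// exprn_ge0// ltW.
    by rewrite invfM mulrA divfK// expf_neq0// gt_eqF.
  rewrite -ge0_sume_distrr; last first.
    move=> q _; apply: adde_ge0 => //; apply: mule_ge0; first by rewrite lee_fin ltW.
    by apply: adde_ge0 => //; rewrite lee_fin divr_ge0// ltW.
  rewrite big_split/= -ge0_sume_distrr; last first.
    by move=> q _; apply: adde_ge0 => //; rewrite lee_fin divr_ge0// ltW.
  rewrite [X in (P%:E * (_ + P%:E * X))%E]big_split/= sumEFin sumr_const.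
  rewrite -(mulr_natr (D / _)) divfK ?gt_eqF//.
  apply: (@le_trans _ _ (P * (D + P * (D + D)))%:E).
    rewrite (EFinM P) lee_pmul2l// (EFinD D) leeD//; first exact: (Ha m).2.
    by rewrite (EFinM P) lee_pmul2l// (EFinD D) leeD2l//; exact: (Ha n).2.
  rewrite lee_fin (_ : eta = P * (1 + 2 * P) * D).
    by rewrite le_eqVlt; apply/orP; left; apply/eqP; ring.
  by rewrite /D mulrC divfK// gt_eqF// mulr_gt0// addr_gt0// mulr_gt0.
case: insubP => [j jn jE [ij]|//] _.
have -> : m = n by rewrite -iE -jE ij.
rewrite /Lp_distE integral0_eq ?lee_fin ?(ltW eta0)// => x _.
by rewrite subrr normr0 powR0// gt_eqF.
Qed.

(** * Passing to the limit *)

Lemma le_limn_einf (R : realType) (u w : nat -> \bar R) (m : nat) :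
  (forall n, (m <= n)%N -> u n <= w n)%E -> (limn_einf u <= limn_einf w)%E.
Proof.
move=> uw; rewrite limn_einf_lim (cvg_lim _ (@cvg_einfs_sup _ u))//.
apply: ge_ereal_sup => _ [n _ <-].
apply: (@limn_einf_ge _ _ _ (maxn m n)) => k; rewrite geq_max => /andP[mk nk].
apply: le_trans (uw k mk); apply: ereal_inf_lbound; by exists k.
Qed.

Lemma liminf0_ge0 (R : realType) (g : R -> R) :
  (forall s, 0 < s < 1 -> 0 <= g s) -> (0 <= liminf0 g)%E.
Proof.
move=> g0; apply: le_ereal_sup_tmp.
exists (ereal_inf [set (g t)%:E | t in `]0, 2^-1[ ]).
  by exists 2^-1 => //=; rewrite in_itv /=; apply/andP; split; lra.
apply: le_ereal_inf_tmp => _ [s /= + <-]; rewrite in_itv /= => s0.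
by rewrite lee_fin g0//; lra.
Qed.

(** The sequence [s] eventually enters every interval ]0, d[, where g is at least its infimum. The
    case l = 0 is separate because [liminf0 g] may be infinite. *)
Lemma mul_liminf0_le (R : realType) (g : R -> R) (s a : nat -> R) (l : R) :
  (forall t, 0 < t < 1 -> 0 <= g t) -> (forall n, 0 < s n < 1) ->
  s n @[n --> \oo] --> 0 -> (forall n, 0 <= a n) -> a n @[n --> \oo] --> l ->
  (l%:E * liminf0 g <= limn_einf (fun n => (a n * g (s n))%:E))%E.
Proof.
move=> g0 s01 s0 a0 al.
have : 0 <= l.
  by rewrite -(cvg_lim _ al)//; apply: limr_ge; [apply/cvg_ex; exists l|exact: nearW].
rewrite le_eqVlt => /predU1P[<-|l0].
  by rewrite mul0e; apply: (@limn_einf_ge _ _ _ 0) => n _; rewrite lee_fin mulr_ge0// g0.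
rewrite -lee_pdivlMl//; apply: ge_ereal_sup => _ [d /= + <-].
rewrite in_itv/= => /andP[d0 d1]; rewrite lee_pdivlMl//.
set c := ereal_inf _.
have c0 : (0 <= c)%E.
  apply: le_ereal_inf_tmp => _ [r /= + <-]; rewrite in_itv/= lee_fin => /andP[r0 rd].
  by rewrite g0// r0 (lt_trans rd).
have cg r : 0 < r < d -> (c <= (g r)%:E)%E.
  by move=> rd; apply: ereal_inf_lbound; exists r => //=; rewrite in_itv.
(* The infimum is at most g(d/2), so the product a_n c can be handled by real limits. *)
have cfin : c \is a fin_num.
  rewrite ge0_fin_numE//; apply: le_lt_trans (cg (d / 2) _) (ltry _).
  by apply/andP; split; lra.
have [m hm] : exists m, forall n, (m <= n)%N -> s n < d.
  have /cvgrPdist_lt/(_ _ d0)[m _ h] := s0; exists m => n /h /=.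
  by rewrite sub0r normrN gtr0_norm//; have /andP[] := s01 n.
have acl : (a n * fine c)%:E @[n --> \oo] --> (l * fine c)%:E.
  by apply: cvg_EFin; [exact: nearW|apply: cvgMr_tmp].
rewrite -(fineK cfin) -EFinM; have [<- _] := cvg_limn_einf_sup acl.
apply: (@le_limn_einf _ _ _ m) => n mn.
rewrite lee_fin ler_wpM2l// -lee_fin fineK// cg//.
by have /andP[-> _] := s01 n; rewrite hm.
Qed.

Lemma homo_ltn_ge_id (phi : nat -> nat) :
  {homo phi : m n / (m < n)%N >-> (m < n)%N} -> forall n, (n <= phi n)%N.
Proof. by move=> h; elim=> // n ih; exact: leq_ltn_trans ih (h _ _ (ltnSn n)). Qed.

(** Asking for error 2^-j on the cube of radius j treats all cubes in a single extraction, since a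
    point lies in all but finitely many of them. The bound [n <= psi n] is what makes t along [psi]
    tend to 0. *)
Lemma Lploc_limit_ae_subsequence (R : realType) (N : nat)
    (mu : {measure set (N.-tuple R) -> \bar R}) (p : R)
    (u : nat -> N.-tuple R -> R) (v : N.-tuple R -> R) :
  0 < p -> (forall k, measurable_fun setT (u k)) -> Lploc_limit mu p u v ->
  exists psi : nat -> nat, (forall n, (n <= psi n)%N) /\
    {ae mu, forall x, u (psi n) x @[n --> \oo] --> v x}.
Proof.
move=> p0 mu_ [mv [phi [/homo_ltn_ge_id phi_ge Hphi]]].
have /choice[k Hk] : forall j : nat, exists n, (j <= n)%N /\
    (Lp_distE mu p (cube j%:R) (u (phi n)) v <= ((2^-1) ^+ j)%:E)%E.
  move=> j; have [_ /fine_cvgP[fin0 cv0]] := Hphi _ (@cube_ecompact R N j%:R).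
  have e0 : 0 < 2^-1 ^+ j :> R by rewrite exprn_gt0.
  move/cvgrPdist_lt : cv0 => /(_ _ e0) h.
  have [m _ hm] : \forall n \near \oo, (Lp_distE mu p (cube j%:R) (u (phi n)) v <= ((2^-1) ^+ j)%:E)%E.
    apply: filterS2 fin0 h => n nfin /=; rewrite sub0r normrN => hn.
    by rewrite -(fineK nfin) lee_fin (le_trans (ler_norm _))// ltW.
  by exists (maxn j m); rewrite leq_maxl; split => //; apply: hm => /=; rewrite leq_maxr.
exists (fun j => phi (k j)); split.
  by move=> j; exact: leq_trans (Hk j).1 (phi_ge _).
pose f j x := \1_(cube j%:R) x * `|u (phi (k j)) x - v x| `^ p.
have : {ae mu, forall x, f n x @[n --> \oo] --> 0}.
  apply: ae_cvg0 => [n x|n|n].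
  - by rewrite mulr_ge0 ?powR_ge0.
  - apply: measurable_funM; last exact: measurable_powR_normB.
    by apply: measurable_indic; exact: measurable_box.
  - apply: le_trans (Hk n).2; rewrite /Lp_distE [leRHS]integral_mkcond.
    rewrite le_eqVlt; apply/orP; left; apply/eqP; apply: eq_integral => x _.
    by rewrite /f patchE indicE; case: ifPn => _; rewrite ?mul1r ?mul0r.
apply: filterS => x fx.
have [J _ xJ] : (\bigcup_n @cube R N n%:R) x by rewrite bigcup_cube.
apply/cvgrPdist_lt => e e0.
have ep0 : 0 < e `^ p by exact: powR_gt0.
have /cvgrPdist_lt/(_ _ ep0)[m _ hm] := fx.
exists (maxn J m) => // n /=; rewrite geq_max => /andP[Jn mn].
have := hm n mn; rewrite /= sub0r normrN /f indicE mem_set ?mul1r; last first.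
  by apply: (le_cube _ xJ); rewrite ler_nat.
rewrite ger0_norm ?powR_ge0// distrC => h; rewrite ltNge; apply/negP => he.
move: h; rewrite ltNge ge0_ler_powR ?nnegrE ?(ltW p0) ?(ltW e0)//.
Qed.

(** Fatou is applied in y for almost every fixed x, then in x, so no null set of pairs is needed.
    [kappa] involves uncountably many t, hence at both levels the limit integrand is treated as
    possibly non-measurable. *)
Lemma Wkp_of_ae_limit (R : realType) (N : nat)
    (mu : {measure set (N.-tuple R) -> \bar R}) (p : R) (rho : R -> N.-tuple R -> R)
    (t : nat -> R) (u : nat -> N.-tuple R -> R) (B M : R) (v : N.-tuple R -> R) :
  is_lebesgue_measure mu -> 0 < p ->
  (forall s, 0 < s < 1 -> measurable_fun setT (rho s)) ->
  (forall s, 0 < s < 1 -> forall z, 0 <= rho s z) ->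
  (forall k, 0 < t k < 1) -> t @ \oo --> (0:R) ->
  (forall k, measurable_fun setT (u k)) ->
  (forall k, (\int[mu]_x (`|u k x| `^ p)%:E <= B%:E)%E) ->
  (forall k, (Ftp mu rho (t k) p (u k) <= M%:E)%E) ->
  measurable_fun setT v -> {ae mu, forall x, u n x @[n --> \oo] --> v x} ->
  Wkp mu (kappa rho p) p v.
Proof.
move=> muL p0 mrho rho0 t01 t0 mu_ uB uM mv uv; split => //.
- have : (\int[mu]_x (`|v x| `^ p)%:E <= B%:E)%E.
    apply: (@fatou_le _ _ _ _ (fun n x => (`|u n x| `^ p)%:E) _ _ 0).
    + by move=> x; rewrite lee_fin powR_ge0.
    + by move=> n x; rewrite lee_fin powR_ge0.
    + move=> n; apply/measurable_EFinP; apply: (measurableT_comp (measurable_powR p)).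
      exact: measurableT_comp.
    + apply: filterS uv => x ux.
      have : (`|u n x| `^ p)%:E @[n --> \oo] --> (`|v x| `^ p)%:E.
        apply: cvg_EFin; first exact: nearW.
        by apply: cvg_powR_ge0 => //; exact: cvg_norm.
      by move=> /cvg_limn_einf_sup[-> _].
    + by move=> n _; exact: uB.
  move=> vB; rewrite unlock poweR_lty//.
  exact: le_lt_trans vB (ltry _).
have sf := lebesgue_sigma_finite muL.
pose F n (z : N.-tuple R * N.-tuple R) :=
  ((`|u n z.1 - u n z.2| `^ p / (enorm (tsub z.1 z.2)) `^ p) * rho (t n) (tsub z.1 z.2)).
have F0 n z : 0 <= F n z.
  by rewrite !mulr_ge0 ?powR_ge0// ?invr_ge0 ?powR_ge0// rho0.
have mF n : measurable_fun setT (F n) by apply: measurable_Ftp_integrand => //; exact: mrho.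
apply: le_lt_trans (ltry M).
have k0 z : (0 <= kappa rho p z)%E.
  by apply: liminf0_ge0 => s s01; rewrite divr_ge0 ?powR_ge0// rho0.
apply: (@fatou_le _ _ _ _ (fun n x => \int[mu]_y (F n (x, y))%:E)%E _ _ 0).
- by move=> x; apply: integral_ge0 => y _; rewrite mule_ge0.
- by move=> n x; apply: integral_ge0 => y _; rewrite lee_fin.
- move=> n; apply: (@measurable_integral_snd _ _ _ _ (EFin \o F n)) => //.
    exact/measurable_EFinP.
  by move=> z; rewrite lee_fin.
- apply: filterS (uv) => x ux.
  have mFx n : measurable_fun setT (fun y => (F n (x, y))%:E).
    by apply/measurable_EFinP; exact: (measurable_fun_slice x (mF n)).
  apply: le_trans (@fatou _ _ _ mu setT measurableT (fun n y => (F n (x, y))%:E)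
    mFx (fun n y _ => F0 n (x, y))).
  apply: ae_ge0_le_integral_lower.
  + by move=> y; rewrite mule_ge0.
  + by move=> y; apply: (@limn_einf_ge _ _ _ 0) => n _; rewrite lee_fin.
  + rewrite (_ : (fun _ => _) = (fun y => - limn_esup (fun n => - (F n (x, y))%:E))%E)//.
    apply: measurableT_comp => //; apply: measurable_fun_limn_esup => n.
    exact: measurableT_comp.
  + apply: filterS uv => y uy.
    have h := @mul_liminf0_le R (fun s => rho s (tsub x y) / enorm (tsub x y) `^ p) t
      (fun n => `|u n x - u n y| `^ p) (`|v x - v y| `^ p).
    (* Regrouping puts the quotient defining [kappa] in one factor and the convergent differences in
       the other. *)
    rewrite (_ : (fun n => (F n (x, y))%:E) = (fun n => (`|u n x - u n y| `^ p *
      (rho (t n) (tsub x y) / enorm (tsub x y) `^ p))%:E)); last first.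
      by apply/funext => n; rewrite /F/=; congr EFin; ring.
    apply: h => //.
    * by move=> s s01; rewrite divr_ge0 ?powR_ge0// rho0.
    * apply: cvg_powR_ge0 => //; apply: cvg_norm; exact: cvgB.
- by move=> n _; exact: uM.
Qed.

Theorem theorem1p5 (R : realType) (N : nat)
  (mu : {measure set (N.-tuple R) -> \bar R})
  (p : R) (rho : R -> N.-tuple R -> R)
  (t : nat -> R) (u : nat -> N.-tuple R -> R) :
  (0 < N)%N ->
  is_lebesgue_measure mu ->
  1 <= p ->
  (* (rho_t)_{t in (0,1)} is a non-negative family in L^1_loc(R^N) *)
  (forall s, 0 < s < 1 ->
     [/\ measurable_fun setT (rho s),
         (forall z, 0 <= rho s z) &
         (forall E, ecompact E -> mu.-integrable E (EFin \o rho s))]) ->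
  (forall eps, 0 < eps -> exists delta : R,
     [/\ 0 < delta, delta <= 1 &
         forall s, 0 < s < delta ->
           {ae mu, forall z, eball0 delta z ->
              1 / (eps * delta ^+ N) <= rho s z / (enorm z) `^ p}]) ->
  (* (t_k) subset (0,1) is infinitesimal *)
  (forall k, 0 < t k < 1) ->
  t @ \oo --> (0:R) ->
  (* (u_k) subset L^p(R^N) with sup_k (||u_k||_p + F_{t_k,p}(u_k)) < oo *)
  (forall k, measurable_fun setT (u k)) ->
  (exists M : R, forall k,
     ('N[mu]_(p%:E) [EFin \o u k] + Ftp mu rho (t k) p (u k) <= M%:E)%E) ->
  locally_precompact_Lp mu p u /\
  (forall v, Lploc_limit mu p u v -> Wkp mu (kappa rho p) p v).
Proof.
move=> N0 muL p1 hrho hlow t01 t0 mu_ [M0 uM0].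
have p0 : 0 < p by exact: lt_le_trans p1.
have mrho s : 0 < s < 1 -> measurable_fun setT (rho s) by case/hrho.
have rho0 s : 0 < s < 1 -> forall z, 0 <= rho s z by case/hrho.
(* The bound must be positive, since eps is later defined by dividing by it. *)
pose M := Num.max M0 1.
have M_gt0 : 0 < M by rewrite lt_max ltr01 orbT.
have uM k : ('N[mu]_(p%:E) [EFin \o u k] + Ftp mu rho (t k) p (u k) <= M%:E)%E.
  by apply: le_trans (uM0 k) _; rewrite lee_fin le_max lexx.
have Ftp_ge0 k : (0 <= Ftp mu rho (t k) p (u k))%E.
  apply: integral_ge0 => x _; apply: integral_ge0 => y _.
  by rewrite lee_fin !mulr_ge0 ?invr_ge0 ?powR_ge0 ?rho0.
have FM k : (Ftp mu rho (t k) p (u k) <= M%:E)%E.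
  by apply: le_trans (uM k); rewrite leeDr// Lnorm_ge0.
have uB k : (\int[mu]_x (`|u k x| `^ p)%:E <= (M `^ p)%:E)%E.
  have := @powR_Lnorm _ _ _ mu (EFin \o u k) p (lt0r_neq0 p0).
  have NM : ('N[mu]_(p%:E) [EFin \o u k] <= M%:E)%E.
    by apply: le_trans (uM k); rewrite leeDl.
  have -> : (\int[mu]_x `|(EFin \o u k) x| `^ p = \int[mu]_x (`|u k x| `^ p)%:E)%E by [].
  move=> <-; rewrite -poweR_EFin.
  by rewrite gt0_ler_poweR// ?(ltW p0)// in_itv/= ?leey ?andbT ?Lnorm_ge0 ?lee_fin ?ltW.
split.
  move=> E cE; have mE := ecompact_measurable cE.
  apply: precompact_LpE_of_colorings => // [k|eta eta0].
    apply: le_lt_trans (ltry (M `^ p)); apply: le_trans (uB k).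
    apply: ge0_subset_integral => //.
    apply/measurable_EFinP; apply: (measurableT_comp (measurable_powR p)).
    exact: measurableT_comp.
  apply: (Lp_colorings (t := t) N0 muL p0 mrho rho0 _ t01 t0 mu_ uB M_gt0 FM cE eta0).
  by move=> eps /hlow[d [d0 _ dae]]; exists d.
move=> v lv; have [mv _] := lv.
have [psi [psi_ge uv]] := Lploc_limit_ae_subsequence p0 mu_ lv.
apply: (Wkp_of_ae_limit (t := t \o psi) (u := fun n => u (psi n)) muL p0 mrho rho0 _ _ _
  (fun k => uB (psi k)) (fun k => FM (psi k)) mv uv) => // [k|]; first exact: t01.
apply/cvgrPdist_lt => e e0; have /cvgrPdist_lt/(_ _ e0)[m _ hm] := t0.
by exists m => // n /= mn; apply: hm => /=; exact: leq_trans mn (psi_ge n).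
Qed.
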